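(* Suppose that each $f_i,g_i:\mathbb{R}^n\to\mathbb{R}$ ($i\in\mathcal{N}=\{1,\dots,N\}$) is convex and twice differentiable, each $h_i:\mathbb{R}^n\to\mathbb{R}$ is affine, Slater's condition holds and there exists a finite optimal solution for the problem $$\min_{z\in\mathbb{R}^n}\ \sum_{i\in\mathcal{N}} f_i(z)\quad\text{s.t.}\quad g_i(z)\le 0,\ h_i(z)=0,\ i\in\mathcal{N},$$ and that the communication graph $\mathcal{G}=(\mathcal{N},\mathcal{E})$ is undirected and connected. Consider the system, for $i\in\mathcal{N}$, $$\dot\rho^i_k=-b^i_k\rho^i_k+c^i_k\nu_i,\quad k=1,\dots,m,\qquad x_i=\sum_{k=1}^m\rho^i_k,$$ $$\nu_i=-\nabla f_i(x_i)-\lambda_i^2\nabla g_i(x_i)-\mu_i\nabla h_i(x_i)+\sum_{j\in\mathcal{N}_i}a_{ij}(x_j-x_i)-\sum_{j\in\mathcal{N}_i}a_{ij}(\xi_j-\xi_i),$$ $$\dot\xi_i=\sum_{j\in\mathcal{N}_i}a_{ij}(x_j-x_i),\qquad \dot\lambda_i=2\lambda_i g_i(x_i),\qquad \dot\mu_i=h_i(x_i),$$ where $m\ge 2$, $b^i_m>\dots>b^i_2>b^i_1=0$ and $c^i_k>0$ for all $i,k$. Then every trajectory of this system with initial condition $\lambda_i(0)>0$ for all $i\in\mathcal{N}$ converges, as $t\to\infty$, to a fixed equilibrium point of the system that solves the problem $$\min_{x\in\mathbb{R}^{nN}}\ \sum_{i\in\mathcal{N}} f_i(x_i)+x^T\mathbf{L}x\quad\text{s.t.}\quad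 g_i(x_i)\le 0,\ h_i(x_i)=0,\ i\in\mathcal{N},\ \ \mathbf{L}x=\mathbf{0},$$ i.e. the $x$-component of the equilibrium point is an optimal solution of this last problem.
   Context: $\mathcal{N}=\{1,\dots,N\}$ is a set of agents. The graph $\mathcal{G}=(\mathcal{N},\mathcal{E})$ has adjacency matrix $\mathcal{A}=[a_{ij}]$ with $a_{ii}=0$, $a_{ij}=a_{ji}>0$ if $(i,j)\in\mathcal{E}$ and $a_{ij}=0$ otherwise; $\mathcal{N}_i=\{j:(i,j)\in\mathcal{E}\}$ is the neighbor set of $i$. $L=\mathrm{diag}\{\mathcal{A}\mathbf{1}_N\}-\mathcal{A}$ is the graph Laplacian and $\mathbf{L}=L\otimes I_n$. State variables: $\rho^i_k\in\mathbb{R}^n$, $\xi_i\in\mathbb{R}^n$, $\lambda_i\in\mathbb{R}$, $\mu_i\in\mathbb{R}$; $x_i\in\mathbb{R}^n$ is the output defined by $x_i=\sum_k\rho^i_k$, and $x=\mathrm{col}(x_1,\dots,x_N)$ is the stacked column vector. Slater's condition: there is $z\in\mathbb{R}^n$ with $g_i(z)<0$ and $h_i(z)=0$ for all $i\in\mathcal{N}$. *)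

(* Defs.v *)
(* MathComp-Analysis, over an arbitrary R : realType. *)
From HB Require Import structures.
From mathcomp Require Import all_boot all_order all_algebra.
From mathcomp Require Export mxtens.
From mathcomp Require Import all_classical all_reals all_analysis.

Set Implicit Arguments.
Unset Strict Implicit.
Unset Printing Implicit Defensive.

Import Order.TTheory GRing.Theory Num.Theory.
Import numFieldNormedType.Exports.

Local Open Scope classical_set_scope.
Local Open Scope ring_scope.

Definition minimizes (R : realType) (T : Type) (D : set T) (F : T -> R) (z : T) :=
  D z /\ forall y, D y -> F z <= F y.

Section functions_on_Rn.
Variables (R : realType) (n : nat).
Implicit Types f h : 'cV[R]_n -> R.

Definition grad f (z : 'cV[R]_n) : 'cV[R]_n :=
  \col_j 'D_(delta_mx j 0) f z.

(* Frechet differentiability everywhere, of f and then of its gradient; no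
   continuity of the second derivative is required. *)
Definition twice_differentiable f :=
  (forall z, differentiable f z) /\ (forall z, differentiable (grad f) z).

Definition affine_function h :=
  exists (a : 'rV[R]_n) (c : R), forall z, h z = (a *m z) 0 0 + c.

End functions_on_Rn.

Section graphs.
Variables (R : realType) (N : nat).
Implicit Types (E : rel 'I_N) (A : 'M[R]_N).

(* The conditions on A exclude self-loops from E. *)
Definition adjacency_matrix E A :=
  [/\ forall i, A i i = 0,
      forall i j, A i j = A j i,
      forall i j, E i j -> 0 < A i j
    & forall i j, ~~ E i j -> A i j = 0].

Definition connected_graph E := forall i j, connect E i j.

Definition laplacian A : 'M[R]_N := diag_mx (A *m const_mx 1)^T - A.

Definition big_laplacian n A : 'M[R]_(N * n) := laplacian A *t 1%:M.

(* mxtens_index orders the pairs (i, j) lexicographically, so that block i is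
   the i-th group of n consecutive coordinates, as the Kronecker product
   requires. *)
Definition stack n (x : 'I_N -> 'cV[R]_n) : 'cV[R]_(N * n) :=
  \col_p x (mxtens_unindex p).1 (mxtens_unindex p).2 0.

Definition block n (x : 'cV[R]_(N * n)) (i : 'I_N) : 'cV[R]_n :=
  \col_j x (mxtens_index (i, j)) 0.

End graphs.

Section problems.
Variables (R : realType) (N n : nat).
Variables (f g h : 'I_N -> 'cV[R]_n -> R) (A : 'M[R]_N).

Definition slater :=
  exists z : 'cV[R]_n, forall i, g i z < 0 /\ h i z = 0.

Definition common_feasible : set 'cV[R]_n :=
  [set z | forall i, g i z <= 0 /\ h i z = 0].

Definition common_optimal : set 'cV[R]_n :=
  minimizes common_feasible (fun z => \sum_i f i z).

Definition stacked_feasible : set 'cV[R]_(N * n) :=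
  [set x | (forall i, g i (block x i) <= 0 /\ h i (block x i) = 0) /\
           big_laplacian n A *m x = 0].

Definition stacked_optimal : set 'cV[R]_(N * n) :=
  minimizes stacked_feasible
    (fun x => \sum_i f i (block x i) + (x^T *m big_laplacian n A *m x) 0 0).

End problems.

Record state (R : realType) (N n m : nat) := State {
  rho : 'I_N -> 'I_m -> 'cV[R]_n ;
  xi : 'I_N -> 'cV[R]_n ;
  lam : 'I_N -> R ;
  mu : 'I_N -> R }.

Section dynamics.
Variables (R : realType) (N n m : nat).
Variables (f g h : 'I_N -> 'cV[R]_n -> R) (E : rel 'I_N) (A : 'M[R]_N).
Variables (b c : 'I_N -> 'I_m -> R).
Implicit Types (s : state R N n m) (S : R -> state R N n m).

Definition output s (i : 'I_N) : 'cV[R]_n := \sum_k rho s i k.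

Definition nu s (i : 'I_N) : 'cV[R]_n :=
  let x := output s in
  - grad (f i) (x i) - lam s i ^+ 2 *: grad (g i) (x i)
  - mu s i *: grad (h i) (x i)
  + \sum_(j | E i j) A i j *: (x j - x i)
  - \sum_(j | E i j) A i j *: (xi s j - xi s i).

Definition vector_field s : state R N n m :=
  let x := output s in
  State (fun i k => - b i k *: rho s i k + c i k *: nu s i)
        (fun i => \sum_(j | E i j) A i j *: (x j - x i))
        (fun i => 2 * lam s i * g i (x i))
        (fun i => h i (x i)).

Definition equilibrium s :=
  [/\ forall i k, rho (vector_field s) i k = 0,
      forall i, xi (vector_field s) i = 0,
      forall i, lam (vector_field s) i = 0
    & forall i, mu (vector_field s) i = 0].

Definition horizon (T : \bar R) : set R := [set t | 0 <= t /\ (t%:E < T)%E].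

(* u' = v on the open interval ]0, T[ and u is continuous on [0, T[; when v is
   continuous this includes the one-sided derivative at 0. *)
Definition primitive_on (V : normedModType R) (T : \bar R) (u v : R -> V) :=
  {within horizon T, continuous u} /\
  forall t : R, 0 < t -> (t%:E < T)%E -> is_derive t 1 u (v t).

Definition solution (T : \bar R) S :=
  [/\ (0 < T)%E,
      forall i k, primitive_on T (fun t => rho (S t) i k)
                                 (fun t => rho (vector_field (S t)) i k),
      forall i, primitive_on T (fun t => xi (S t) i)
                               (fun t => xi (vector_field (S t)) i),
      forall i, primitive_on T (fun t => (lam (S t) i : R^o))
                               (fun t => lam (vector_field (S t)) i)
    & forall i, primitive_on T (fun t => (mu (S t) i : R^o))
                               (fun t => mu (vector_field (S t)) i)].

(* The values of S outside [0, T[ are irrelevant. *)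
Definition trajectory (T : \bar R) S :=
  solution T S /\
  forall T' S', solution T' S' -> (T <= T')%E ->
    (forall t, horizon T t -> S' t = S t) -> T' = T.

Definition converges_to S s :=
  [/\ forall i k, (fun t => rho (S t) i k) @ +oo --> rho s i k,
      forall i, (fun t => xi (S t) i) @ +oo --> xi s i,
      forall i, (fun t => lam (S t) i) @ +oo --> lam s i
    & forall i, (fun t => mu (S t) i) @ +oo --> mu s i].

End dynamics.

(* Main.v *)
Require Import Defs.
From HB Require Import structures.
From mathcomp Require Import all_boot all_order all_algebra.
From mathcomp Require Import all_classical all_reals all_analysis.
From mathcomp Require Import ring lra.

Set Implicit Arguments.
Unset Strict Implicit.
Unset Printing Implicit Defensive.

Import Order.TTheory GRing.Theory Num.Theory.
Import numFieldNormedType.Exports.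

Local Open Scope classical_set_scope.
Local Open Scope ring_scope.

(* Each equilibrium p with nonnegative multipliers yields the function
     sum |rho - rho_p|^2 / (2 c) + |xi - xi_p|^2 / 2 + |mu - mu_p|^2 / 2
       + sum (lam^2 - lam_p^2 - 2 lam_p^2 ln (lam / lam_p)) / 4,
   whose derivative along the flow is - (dissipation) + sum_i lam_i^2 g_i(x_p). For p
   feasible (one exists by the Karush-Kuhn-Tucker theorem) it decreases, so trajectories
   are bounded, and they are global by Peano's theorem; the vector field is merely
   continuous, since the gradients of f_i are not assumed to be locally Lipschitz.
   By Barbalat-type arguments every limit point q is an equilibrium at which the
   dissipation vanishes, but g_i(x_q) > 0 with lam_i = 0 is not excluded at this stage.
   The point formed of rho_p and of the multipliers of q is again a feasible equilibrium;
   comparing the corresponding functions at two limit points shows that all limit points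
   have the same lam, i.e. lam(t) converges. Then near q the positive terms
   lam_i^2 g_i(x_q) of the derivative of the function based at q itself are dominated by
   the derivative of lam_i^2, which tends to 0: the trajectory is captured by q. Hence it
   converges to q, and g_i(x_q) > 0 is now impossible because lam_i would increase. *)

(** * Limits along ultrafilters and Peano's theorem *)

(** Limit points are limits along ultrafilters finer than the filter at infinity. Bounded functions
    converge along them, and a function with the same limit along all of them converges at infinity,
    so no subsequence is ever extracted. The vanishing of the dissipation is weak: without strict
    convexity it identifies gradients, not outputs, and [nu] does not occur in it. The way out is a
    component of [rho] with [b i k != 0]. The dissipation drives it to 0, and Barbalat's argument
    applied to this component itself gives [nu = 0] at limit points. All rates of [rho] then tend to
    0, so outputs are almost frozen over windows of any fixed length, and a multiplier drifting over
    such a window would leave every bounded set. Feasibility has to come last: the Lyapunov function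
    of a limit point is known to be monotone only if that point is feasible, so monotonicity cannot
    be used to approach it. *)

Lemma bounded_cvg_ultra (R : realType) (T : Type) (U : set_system T)
    (f : T -> R) (M : R) :
  UltraFilter U -> (\forall t \near U, `|f t| <= M) ->
  exists l : R, f @ U --> l.
Proof.
move=> UU fM; have UP : ProperFilter U := ultra_proper.
have [|l [_ cl]] := @segment_compact R (- M) M (f @ U) _.
  by apply: filterS fM => t; rewrite /= in_itv /= -ler_norml.
(* An ultrafilter converges to its cluster points: otherwise it would contain the complement of a
   neighbourhood of [l]. *)
exists l => A lA; have [//|nA] := in_ultra_setVsetC (f @^-1` A) UU.
have [y [nAy Ay]] := cl (~` A) A nA lA.
by case: nAy.
Qed.

(** If convergence fails for some [e], the set where [f] stays at distance at least [e] from [l]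
    meets every member of [F]; an ultrafilter refining this trace of [F] contradicts the
    hypothesis. *)
Lemma cvg_ultra (R : realType) (T : Type) (F : set_system T)
    (f : T -> R) (l : R) :
  ProperFilter F ->
  (forall U, UltraFilter U -> F `<=` U -> f @ U --> l) -> f @ F --> l.
Proof.
move=> FF Ul; apply/cvgrPdist_lt => e e0; apply: contrapT => nF.
pose B := [set t | ~ `|l - f t| < e].
have GF : ProperFilter (within B F).
  apply: Build_ProperFilter => H; apply: nF.
  have {}H : F [set t | B t -> False] := H.
  by apply: filterS H => t nBt; apply: contrapT.
have [U [UU FU]] := ultraFilterLemma GF.
have /Ul/cvgrPdist_lt/(_ _ e0) h : F `<=` U.
  by move=> A FA; apply: FU; apply: filterS FA => t.
have UB : U B by apply: FU; exact: withinT.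
have /filter_ex[t [Bt lt]] : U (B `&` [set t | `|l - f t| < e]) by exact: filterI.
by case: Bt.
Qed.

(** * Scalar primitives and mean value estimates *)

Section primitives.
Variable R : realType.
Implicit Types (T : \bar R) (u v : R -> R).

Definition scalar_primitive T u v :=
  (forall t, horizon T t -> u @ within (horizon T) (nbhs t) --> u t) /\
  (forall t, 0 < t -> (t%:E < T)%E -> is_derive t 1 u (v t)).

Lemma primitive_onP T u v :
  primitive_on T (u : R -> R^o) v <-> scalar_primitive T u v.
Proof. by split=> -[cu du]; split=> //; exact/subspace_continuousP. Qed.

Lemma primitive_continuous T u v a b : scalar_primitive T u v ->
  0 <= a -> (b%:E < T)%E -> {within `[a, b], continuous u}.
Proof.
move=> [/subspace_continuousP cu _] a0 bT; apply: continuous_subspaceW cu => t.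
rewrite /= in_itv /= => /andP[at_ tb]; split; first exact: le_trans at_.
by apply: le_lt_trans bT; rewrite lee_fin.
Qed.

Lemma primitive_mvt T u v a b : scalar_primitive T u v ->
  0 <= a -> a < b -> (b%:E < T)%E ->
  exists2 c, a < c < b & u b - u a = v c * (b - a).
Proof.
move=> uv a0 ab bT.
have [|c /[!in_itv]/= cab ->] := @MVT R u v a b ab _ (primitive_continuous uv a0 bT).
  move=> x; rewrite in_itv /= => /andP[ax xb]; apply: uv.2.
    exact: le_lt_trans ax.
  by apply: lt_trans bT; rewrite lte_fin.
by exists c.
Qed.

(** The bound is required only after [x] because outputs move slowly only at late times. *)
Lemma primitive_lipschitz_after T u v K x s t : scalar_primitive T u v ->
  0 <= x -> (forall r, x < r -> (r%:E < T)%E -> `|v r| <= K) ->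
  x <= s -> x <= t -> (s%:E < T)%E -> (t%:E < T)%E -> `|u s - u t| <= K * `|s - t|.
Proof.
move=> uv x0 vK; wlog st : s t / s < t => [wh xs xt sT tT|xs xt sT tT].
  have [->|/lt_total/orP[|]] := eqVneq s t; first by rewrite !subrr normr0 mulr0.
    by move/wh => /(_ xs xt sT tT).
  by move/wh => /(_ xt xs tT sT); rewrite distrC (distrC t).
have [r /andP[sr rt] e] := primitive_mvt uv (le_trans x0 xs) st tT.
rewrite distrC e normrM (distrC s) ler_wpM2r// vK//; first exact: le_lt_trans xs sr.
by apply: lt_trans tT; rewrite lte_fin.
Qed.

Lemma primitive_lipschitz T u v K s t : scalar_primitive T u v ->
  (forall r, 0 < r -> (r%:E < T)%E -> `|v r| <= K) ->
  horizon T s -> horizon T t -> `|u s - u t| <= K * `|s - t|.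
Proof.
move=> uv vK [s0 sT] [t0 tT].
exact: (primitive_lipschitz_after uv (lexx 0) vK).
Qed.

Lemma primitive_nonincreasing T u v a b : scalar_primitive T u v ->
  0 <= a -> a <= b -> (b%:E < T)%E ->
  (forall r, a < r < b -> v r <= 0) -> u b <= u a.
Proof.
move=> uv a0; rewrite le_eqVlt => /predU1P[->//|ab bT v0].
have [c cab e] := primitive_mvt uv a0 ab bT.
by rewrite -subr_le0 e mulr_le0_ge0 ?v0// subr_ge0 ltW.
Qed.

End primitives.

Section peano.
Variables (R : realType) (I : finType).
Implicit Types (p q : I -> R) (e : R).

Definition coord_cvg (T : Type) (G : set_system T) (u : T -> I -> R) p :=
  forall a, u^~ a @ G --> p a.

Definition coord_nbhs p : set_system (I -> R) :=
  filter_from [set d : R | 0 < d] (fun d => [set q | forall a, `|q a - p a| < d]).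

Lemma coord_nbhs_filter p : ProperFilter (coord_nbhs p).
Proof.
apply: filter_from_proper.
  apply: filter_from_filter; first by exists 1; exact: ltr01.
  move=> d e d0 e0; exists (Num.min d e); first by rewrite /= lt_min d0.
  by move=> q /= h; split => a; have := h a; rewrite lt_min => /andP[].
by move=> d d0; exists p => a; rewrite subrr normr0.
Qed.

Variable F : (I -> R) -> (I -> R).
Hypothesis F_cont : forall (T : Type) (G : set_system T) u p, ProperFilter G ->
  coord_cvg G u p -> coord_cvg G (F \o u) (F p).

(** The identity converges to [p] along [coord_nbhs p]. Continuity along filters thus yields an
    estimate that is uniform in the finitely many coordinates. *)
Lemma filter_continuous_eps p e : 0 < e ->
  exists2 d : R, 0 < d &
    forall q, (forall a, `|q a - p a| < d) -> forall a, `|F q a - F p a| < e.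
Proof.
move=> e0; have PF := coord_nbhs_filter p.
have /F_cont h : coord_cvg (coord_nbhs p) id p.
  move=> a; apply/cvgrPdist_lt => d d0; exists d => // q /(_ a).
  by rewrite distrC.
have : \forall q \near coord_nbhs p, forall a, `|F p a - F q a| < e.
  by apply: filter_forall => a; have /cvgrPdist_lt := h a; apply.
by move=> [d d0 dF]; exists d => // q /dF + a => /(_ a); rewrite distrC.
Qed.

End peano.

(** * Euler polygons for a bounded continuous field *)

Section euler.
Variables (R : realType) (I : finType).
Implicit Types (p q : I -> R) (e d h s t r : R).
Variable F : (I -> R) -> (I -> R).
Hypothesis F_eps : forall p (e : R), 0 < e ->
  exists2 d : R, 0 < d &
    forall q, (forall a, `|q a - p a| < d) -> forall a, `|F q a - F p a| < e.
Variable K : R.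
Hypothesis K_gt0 : 0 < K.
Hypothesis F_bounded : forall q a, `|F q a| <= K.
Variable p0 : I -> R.

Fixpoint euler (h : R) (j : nat) : I -> R :=
  if j is i.+1 then fun a => euler h i a + h * F (euler h i) a else p0.

(** A step function that takes the value of the last node before [t]. It differs from the
    interpolated polygon by at most [h * K], which disappears in the limit. *)
Definition polygon (h t : R) := euler h (Num.truncn (t / h)).

Lemma euler_increment h (c : R) e a j l : 0 <= h -> (j <= l)%N ->
  (forall i, (j <= i < l)%N -> `|F (euler h i) a - c| <= e) ->
  `|euler h l a - euler h j a - (h * (l - j)%:R) * c| <= (h * (l - j)%:R) * e.
Proof.
move=> h0; elim: l => [|l IH].
  by rewrite leqn0 => /eqP-> _; rewrite !subrr mulr0 !mul0r subrr normr0.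
rewrite leq_eqVlt => /predU1P[-> _|]; first by rewrite subrr subnn mulr0 !mul0r subrr
  normr0.
rewrite ltnS => jl Fe.
have {}IH : `|euler h l a - euler h j a - h * (l - j)%:R * c| <= h * (l - j)%:R * e.
  by apply: IH => // i /andP[ji il]; apply: Fe; rewrite ji leqW.
have Fl : `|F (euler h l) a - c| <= e by apply: Fe; rewrite jl /=.
rewrite subSn// -natr1 /=.
have -> : euler h l a + h * F (euler h l) a - euler h j a
   - h * ((l - j)%:R + 1) * c =
  (euler h l a - euler h j a - h * (l - j)%:R * c) + h * (F (euler h l) a - c).
  by ring.
have -> : h * ((l - j)%:R + 1) * e = h * (l - j)%:R * e + h * e by ring.
apply: le_trans (ler_normD _ _) _.
by rewrite lerD// normrM (ger0_norm h0) ler_wpM2l.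
Qed.

Lemma euler_lipschitz h a j l : 0 <= h -> (j <= l)%N ->
  `|euler h l a - euler h j a| <= h * (l - j)%:R * K.
Proof.
move=> h0 jl; have := @euler_increment h 0 K a j l h0 jl.
by rewrite mulr0 subr0; apply=> i _; rewrite subr0.
Qed.

Lemma truncn_step h s t : 0 < h -> 0 <= s -> s <= t ->
  `|h * (Num.truncn (t / h) - Num.truncn (s / h))%:R - (t - s)| <= h.
Proof.
move=> h0 s0 st; have t0 := le_trans s0 st.
have sth : s / h <= t / h by rewrite ler_pM2r ?invr_gt0.
have js := truncn_itv (divr_ge0 s0 (ltW h0)).
have jt := truncn_itv (divr_ge0 t0 (ltW h0)).
rewrite natrB; last exact: le_truncn.
move: js jt; set x := Num.truncn (s / h); set y := Num.truncn (t / h).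
rewrite !ler_pdivlMr// !ltr_pdivrMr// -!natr1.
by move=> /andP[? ?] /andP[? ?]; rewrite ler_norml; apply/andP; split; lra.
Qed.

Lemma truncn_le h s t : 0 < h -> 0 <= s -> s <= t ->
  (Num.truncn (s / h) <= Num.truncn (t / h))%N.
Proof. by move=> h0 s0 st; apply: le_truncn; rewrite ler_pM2r ?invr_gt0. Qed.

(** [r] is the endpoint known to be close to [q]: the left one for increments after the base time,
    the right one for increments before it. The error is [e] per unit of time for the variation of
    [F], plus [h * K] for rounding the duration to a multiple of [h]. *)
Lemma polygon_increment h s t r q d e : 0 < h -> 0 <= s -> s <= t ->
  (r = s \/ r = t) ->
  (forall q', (forall a, `|q' a - q a| < d) -> forall a, `|F q' a - F q a| < e) ->
  (forall a, `|polygon h r a - q a| < d / 2) ->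
  K * (t - s + h) < d / 2 ->
  forall a, `|polygon h t a - polygon h s a - (t - s) * F q a| <=
    (t - s + h) * e + h * K.
Proof.
move=> h0 s0 st rst Fq rq Kd a; have := truncn_le h0 s0 st.
have := truncn_step h0 s0 st; rewrite /polygon.
set x := Num.truncn (s / h); set y := Num.truncn (t / h).
rewrite ler_norml => /andP[xy1 xy2] xy.
have near_q i : (x <= i <= y)%N -> forall b, `|euler h i b - q b| < d.
  move=> /andP[xi iy] b; apply: (@le_lt_trans _ _ (K * (t - s + h) + `|polygon h r b - q
    b|)).
    rewrite -(subrK (polygon h r b) (euler h i b)) -addrA.
    apply: le_trans (ler_normD _ _) _; rewrite lerD2r.
    have le1 j l : (x <= j <= l)%N -> (l <= y)%N ->
        `|euler h l b - euler h j b| <= K * (t - s + h).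
      move=> /andP[xj jl] ly; apply: le_trans (euler_lipschitz _ (ltW h0) jl) _.
      rewrite mulrC ler_wpM2l ?(ltW K_gt0)//.
      apply: (@le_trans _ _ (h * (y - x)%:R)); last lra.
      by rewrite ler_wpM2l ?(ltW h0)// ler_nat leq_sub.
    case: rst => ->; first by apply: le1 => //; rewrite leqnn.
    by rewrite distrC; apply: le1 => //; rewrite xi.
  by have := rq b; lra.
have := @euler_increment h (F q a) e a x y (ltW h0) xy.
set A := euler h y a - euler h x a; set B := h * (y - x)%:R in xy1 xy2 *.
have e0 : 0 < e.
  by apply: le_lt_trans (Fq (polygon h r) _ a) => // b; have := rq b; have := normr_ge0
    (polygon h r b - q b); lra.
have B0 : 0 <= B by rewrite mulr_ge0// ltW.
move=> H; have {}H : `|A - B * F q a| <= B * e.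
  apply: H => i /andP[xi iy]; apply: ltW; apply: Fq; apply: near_q.
  by rewrite xi ltnW.
have -> : A - (t - s) * F q a = (A - B * F q a) + (B - (t - s)) * F q a by ring.
apply: le_trans (ler_normD _ _) _; apply: lerD.
  by apply: le_trans H _; rewrite ler_wpM2r ?(ltW e0)//; lra.
rewrite normrM ler_pM//.
by rewrite ler_norml; apply/andP; split; lra.
Qed.

Lemma polygon_bounded h t a : 0 < h -> h <= 1 -> 0 <= t ->
  `|polygon h t a| <= `|p0 a| + (t + 1) * K.
Proof.
move=> h0 h1 t0; rewrite -[polygon h t a](subrKC (p0 a)).
apply: le_trans (ler_normD _ _) _; rewrite lerD2l.
have := euler_lipschitz a (ltW h0) (leq0n (Num.truncn (t / h))).
rewrite /polygon subn0 => /le_trans; apply; rewrite ler_wpM2r ?(ltW K_gt0)//.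
have := truncn_step h0 (lexx 0) t0.
by rewrite mul0r truncn0 subn0 ler_norml => /andP[_]; lra.
Qed.

(* Pointwise limits of the Euler polygons along an ultrafilter spare the equicontinuous
   extraction of a subsequence. *)
Lemma peano_global : exists v : R -> I -> R, v 0 = p0 /\
  forall s : R, 0 <= s -> forall e : R, 0 < e -> exists2 d : R, 0 < d &
  forall t : R, 0 <= t -> `|t - s| < d -> forall a,
    `|v t a - v s a - (t - s) * F (v s) a| <= e * `|t - s|.
Proof.
have [U [UU ooU]] := ultraFilterLemma (eventually_filter).
pose h (k : nat) : R := k.+1%:R^-1.
have h0 k : 0 < h k by rewrite invr_gt0.
have h1 k : h k <= 1 by rewrite invf_le1// ler1n.
have hU : h @ U --> 0.
  by apply: cvg_trans (@cvg_harmonic R) => A /ooU.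
have lim t a : 0 <= t -> exists l : R, polygon (h k) t a @[k --> U] --> l.
  move=> t0; apply: (@bounded_cvg_ultra _ _ U (fun k => polygon (h k) t a) (`|p0 a| + (t +
    1) * K)).
  by apply: filterE => k; exact: polygon_bounded.
pose v t a := if pselect (0 <= t) is left t0 then xget 0 [set l | polygon (h k) t a @[k -->
  U] --> l] else 0.
have vE t a : 0 <= t -> polygon (h k) t a @[k --> U] --> v t a.
  move=> t0; rewrite /v; case: pselect => // _.
  by case: (lim t a t0) => l hl; case: xgetP => [y -> //|/(_ l)].
exists v; split.
  apply/funext => a; have /cvg_lim <- // := vE 0 a (lexx _).
  rewrite /polygon; under eq_fun do rewrite mul0r truncn0 /=.
  exact: lim_cst.
move=> s s0 e e0; have [d d0 Fd] := F_eps (v s) e0.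
(* The polygon moves by less than [d / 4] over such a duration; another [d / 4] is kept for the
   discretisation [K * h k]. *)
exists (d / (4 * K)); first by rewrite divr_gt0// mulr_gt0.
move=> t t0 std a.
have Kts : K * `|t - s| < d / 4.
  by move: std; rewrite ltr_pdivlMr ?mulr_gt0//; lra.
suff H : \forall k \near U, `|polygon (h k) t a - polygon (h k) s a - (t - s) * F (v s) a|
  <= (`|t - s| + h k) * e + h k * K.
  have c1 : (`|polygon (h k) t a - polygon (h k) s a - (t - s) * F (v s) a|) @[k --> U] -->
    `|v t a - v s a - (t - s) * F (v s) a|.
    by apply: cvg_norm; apply: cvgB; [apply: cvgB; exact: vE|exact: cvg_cst].
  have c2 : (`|t - s| + h k) * e + h k * K @[k --> U] --> (`|t - s| + 0) * e + 0 * K.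
    apply: cvgD; apply: cvgM; try exact: cvg_cst; last exact: hU.
    by apply: cvgD; [exact: cvg_cst|exact: hU].
  rewrite addr0 mul0r addr0 mulrC in c2.
  rewrite -(cvg_lim _ c1)// -(cvg_lim _ c2)//.
  by apply: ler_lim => //; [exact: cvgP c1|exact: cvgP c2].
have nears : \forall k \near U, forall b, `|polygon (h k) s b - v s b| < d / 2.
  apply: filter_forall => b; have /cvgrPdist_lt := vE s b s0.
  have d2 : 0 < d / 2 by rewrite divr_gt0.
  by move=> /(_ _ d2); apply: filterS => k; rewrite distrC.
have nearh : \forall k \near U, K * h k < d / 4.
  have d4 : 0 < d / (4 * K) by rewrite divr_gt0// mulr_gt0.
  have /cvgrPdist_lt/(_ _ d4) := hU; apply: filterS => k.
  by rewrite sub0r normrN gtr0_norm// ltr_pdivlMr ?mulr_gt0//; lra.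
near=> k.
have [st|ts] := leP s t.
  have -> : `|t - s| = t - s by rewrite ger0_norm// subr_ge0.
  apply: (@polygon_increment (h k) s t s (v s) d e) => //; first by left.
    by near: k.
  rewrite ger0_norm ?subr_ge0// in Kts.
  rewrite mulrDr; have : K * h k < d / 4 by near: k.
  lra.
have tsE : `|t - s| = s - t by rewrite distrC gtr0_norm// subr_gt0.
rewrite tsE -normrN.
have -> : - (polygon (h k) t a - polygon (h k) s a - (t - s) * F (v s) a) =
  polygon (h k) s a - polygon (h k) t a - (s - t) * F (v s) a by ring.
apply: (@polygon_increment (h k) t s s (v s) d e) => //; [exact: ltW|by right| |].
  by near: k.
rewrite tsE in Kts.
rewrite mulrDr; have : K * h k < d / 4 by near: k.
lra.
Unshelve. all: by end_near. Qed.

End euler.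

Lemma cvg_withinS (T : Type) (V : topologicalType) (G : set_system T)
    (A B : set T) (f : T -> V) (l : V) : Filter G -> A `<=` B ->
  f @ within B G --> l -> f @ within A G --> l.
Proof.
move=> FG AB fl D lD; have : G [set x | B x -> D (f x)] := fl D lD.
by move=> h; rewrite /= /within /=; apply: filterS h => x h Ax; exact/h/AB.
Qed.

Lemma is_derive_increment (R : realType) (u : R -> R) (s l : R) :
  (forall e : R, 0 < e -> \forall t \near s, `|u t - u s - (t - s) * l| <= e * `|t - s|) ->
  is_derive s 1 u l.
Proof.
move=> H; suff L : h^-1 *: (u (h *: 1 + s) - u s) @[h --> (0 : R)^'] --> l.
  by apply: DeriveDef; [exact: cvgP L|exact: cvg_lim L].
apply/cvgrPdist_le => e e0; have {}H := H e e0.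
have c : (h *: 1 + s : R) @[h --> (0 : R)^'] --> s.
  have : (h *: 1 + s : R) @[h --> (0 : R)] --> 0 *: 1 + s.
    by apply: cvgD; [apply: cvgZ => //; exact: cvg_cst|exact: cvg_cst].
  rewrite scale0r add0r => h; apply: cvg_trans h; apply: cvg_app.
  exact: cvg_within.
have {}c := c _ H; near=> h.
have h0 : h != 0 by near: h; exact: nbhs_dnbhs_neq.
have : `|u (h *: 1 + s) - u s - (h *: 1 + s - s) * l| <= e * `|h *: 1 + s - s|.
  by near: h.
rewrite addrK /GRing.scale /= mulr1 => le.
rewrite distrC -(ler_pM2r (x := `|h|)) ?normr_gt0// -normrM mulrBl.
by rewrite mulrAC mulVf// mul1r [l * h]mulrC.
Unshelve. all: by end_near. Qed.

(** By the mean value theorem, difference quotients at [s] are values of [v] at intermediate points.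
    This settles the junction time when two solutions are glued. *)
Lemma is_derive_limit (R : realType) (u v : R -> R) (s l : R) :
  {for s, continuous u} ->
  (\forall t \near s, t != s -> is_derive t 1 u (v t)) ->
  v @ s^' --> l -> is_derive s 1 u l.
Proof.
move=> us /nbhs_ballP[d /= d0 du] vl; apply: is_derive_increment => e e0.
have /cvgrPdist_le/(_ _ e0)/nbhs_ballP[d' /= d'0 vd'] := vl.
have cu t : ball s d t -> {for t, continuous u}.
  have [-> //|ts] := eqVneq t s.
  by move=> /du/(_ ts)[ut _]; apply/differentiable_continuous/derivable1_diffP.
have mvt a b : a < b -> ball s d a -> ball s d b -> (a = s \/ b = s) ->
    exists2 c, a < c < b & u b - u a = v c * (b - a).
  move=> ab; rewrite /ball /= !ltr_distl => /andP[a1 a2] /andP[b1 b2] abs.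
  have [|/= |c] := @MVT R u v a b ab.
  - move=> x; rewrite in_itv /= => /andP[ax xb]; apply: du.
      by rewrite /ball /= ltr_distl; apply/andP; split; lra.
    by apply/eqP => xs; case: abs; lra.
  - apply: continuous_in_subspaceT => x; rewrite inE /= in_itv /= => /andP[ax xb].
    by apply: cu; rewrite /ball /= ltr_distl; apply/andP; split; lra.
  - by rewrite in_itv /=; exists c.
have dd0 : 0 < Num.min d d' by rewrite lt_min d0.
apply/nbhs_ballP; exists (Num.min d d') => //= t; rewrite /ball /= lt_min => /andP[td td'].
have [->|] := eqVneq t s; first by rewrite !subrr mul0r subrr !normr0 mulr0.
have ss : ball s d s by exact: ballxx.
rewrite neq_lt => /orP[ts|st].
  have [c /andP[tc cs] E] := mvt t s ts td ss (or_intror erefl).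
  have : `|l - v c| <= e.
    by apply: vd'; [move: td'; rewrite /ball /= !ltr_distl => /andP[? ?]; apply/andP;
      split; lra|rewrite lt_eqF].
  have -> : u t - u s - (t - s) * l = (l - v c) * (s - t) by move: E; lra.
  by rewrite normrM (distrC t) => ?; rewrite ler_wpM2r.
have [c /andP[tc cs] E] := mvt s t st ss td (or_introl erefl).
have : `|l - v c| <= e.
  by apply: vd'; [move: td'; rewrite /ball /= !ltr_distl => /andP[? ?]; apply/andP; split;
    lra|rewrite gt_eqF].
have -> : u t - u s - (t - s) * l = (v c - l) * (t - s) by rewrite E; ring.
by rewrite normrM distrC => ?; rewrite ler_wpM2r.
Qed.

(** * Local existence and continuation of solutions *)

Section continuation.
Variables (R : realType) (I : finType).
Implicit Types (p q : I -> R) (e d s t : R).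
Variable F : (I -> R) -> (I -> R).
Hypothesis F_cont : forall (T : Type) (G : set_system T) u p, ProperFilter G ->
  coord_cvg G u p -> coord_cvg G (F \o u) (F p).

Definition coord_solution (T : \bar R) (y : R -> I -> R) :=
  forall a, scalar_primitive T (y^~ a) (fun t => F (y t) a).

(** Composing [F] with the truncation [clamp] to a box around [p] makes it bounded everywhere, so
    that the global version applies; the solution obtained solves the original equation as long as
    it stays in the box. *)
Lemma peano_local p : exists2 T : R, 0 < T &
  exists2 y, y 0 = p & coord_solution T%:E y.
Proof.
have [d d0 Fd] := filter_continuous_eps F_cont p ltr01.
pose clamp q a : R := p a + Num.max (- (d / 2)) (Num.min (d / 2) (q a - p a)).
have clamp_near q a : `|clamp q a - p a| < d.
  rewrite /clamp addrC addKr; apply: (@le_lt_trans _ _ (d / 2)); last by lra.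
  by rewrite ler_norml le_max lexx /= ge_max ge_min lexx /= andbT; lra.
have clamp_id q : (forall a, `|q a - p a| <= d / 2) -> clamp q = q.
  move=> h; apply/funext => a; have := h a; rewrite ler_norml /clamp => /andP[h1 h2].
  by rewrite min_r// max_r// subrKC.
have clamp_lip q q' a : `|clamp q a - clamp q' a| <= `|q a - q' a|.
  rewrite /clamp; set x := q a - p a; set x' := q' a - p a.
  have -> : q a - q' a = x - x' by rewrite /x /x'; ring.
  rewrite opprD addrACA subrr add0r.
  have [? ?] : x - x' <= `|x - x'| /\ x' - x <= `|x - x'|.
    by split; [|rewrite distrC]; exact: ler_norm.
  rewrite ler_norml /Order.max /Order.min.
  by case: (ltP (d / 2) x) => ?; case: (ltP (d / 2) x') => ?; case: ltP => ?;
    case: ltP => ?; apply/andP; split; lra.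
pose K : R := 1 + \sum_a `|F p a|.
have K0 : 0 < K by rewrite ltr_pwDl// sumr_ge0.
have FK q a : `|F (clamp q) a| <= K.
  rewrite -[F _ _](subrK (F p a)); apply: le_trans (ler_normD _ _) _.
  apply: lerD; first by apply: ltW; apply: Fd => b; exact: clamp_near.
  by rewrite (bigD1 a)//= lerDl sumr_ge0.
have F_eps q e : 0 < e -> exists2 d' : R, 0 < d' &
    forall q', (forall a, `|q' a - q a| < d') -> forall a, `|F (clamp q') a - F (clamp q)
      a| < e.
  move=> e0; have [d' d'0 Fd'] := filter_continuous_eps F_cont (clamp q) e0.
  exists d' => // q' h; apply: Fd' => a.
  exact: le_lt_trans (clamp_lip _ _ _) (h a).
have [y [y0 yF]] := peano_global F_eps K0 FK p.
have py a : scalar_primitive +oo%E (y^~ a) (fun t => F (clamp (y t)) a).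
  split=> [s [s0 _]|s s0 _].
    apply/cvgrPdist_le => e e0.
    have [d' d'0 yd] := yF s s0 1 ltr01.
    have K1 : 0 < 1 + K := addr_gt0 ltr01 K0.
    have e'0 : 0 < e / (1 + K) by rewrite divr_gt0.
    have m0 : 0 < Num.min d' (e / (1 + K)) by rewrite lt_min d'0.
    apply/nbhs_ballP; exists (Num.min d' (e / (1 + K))) => //= t.
    rewrite /ball /= lt_min ltr_pdivlMr// => /andP[td te] [t0 _].
    rewrite distrC in td; have le1 := yd t t0 td a.
    rewrite distrC -[y t a - y s a](subrK ((t - s) * F (clamp (y s)) a)).
    apply: le_trans (ler_normD _ _) _; rewrite normrM.
    have := ler_wpM2l (normr_ge0 (t - s)) (FK (y s) a).
    by rewrite (distrC s) in te; lra.
  apply: is_derive_increment => e e0; have [d' d'0 yd] := yF s (ltW s0) e e0.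
  near=> t; apply: yd.
    by apply: ltW; near: t; exact: lt_nbhsr.
  rewrite distrC; near: t; exact: nbhsx_ballx.
(* At speed at most [K], leaving the box of radius [d / 2] takes at least this time. *)
exists (d / 2 / K); first by rewrite !divr_gt0.
exists y => // a; split.
  move=> t [t0 _]; have ct := (py a).1 t (conj t0 (ltry t)).
  by apply: cvg_withinS ct => x [x0 _]; split=> //; rewrite ltry.
move=> t t0; rewrite lte_fin ltr_pdivlMr// => tT.
rewrite -[X in F X](clamp_id (y t)); first by apply: (py a).2; rewrite ?ltry.
move=> b; have -> : p b = y 0 b by rewrite y0.
apply: (@le_trans _ _ (K * `|t - 0|)); last by rewrite subr0 gtr0_norm// mulrC ltW.
by apply: (primitive_lipschitz (py b)) => [r _ _| |]; [exact: FK|split; rewrite ?ltry//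
  ltW|split; rewrite ?ltry].
Unshelve. all: by end_near. Qed.

(** [u] is Lipschitz. An ultrafilter provides a candidate [l], the Lipschitz estimate extends to the
    endpoint with value [l], and this estimate gives the limit along the whole left filter. *)
Lemma left_limit (T K : R) (u v : R -> R) : 0 < T -> scalar_primitive T%:E u v ->
  (forall r, 0 < r < T -> `|v r| <= K) ->
  exists l : R, u @ T^'- --> l.
Proof.
move=> T0 uv vK.
have lip s t : 0 <= s < T -> 0 <= t < T -> `|u s - u t| <= K * `|s - t|.
  move=> /andP[s0 sT] /andP[t0 tT]; apply: (primitive_lipschitz uv); last 2 first.
  - by split; rewrite ?lte_fin.
  - by split; rewrite ?lte_fin.
  - by move=> r r0; rewrite lte_fin => rT; apply: vK; rewrite r0.
have K0 : 0 <= K.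
  by apply: le_trans (vK (T / 2) _); rewrite // divr_gt0//=; lra.
have [U [UU TU]] := ultraFilterLemma (at_left_proper_filter T).
have nearT : \forall t \near T^'-, 0 <= t < T.
  near=> t; apply/andP; split; last by near: t; exact: nbhs_left_lt.
  by near: t; exact: nbhs_left_ge.
have [|l ul] := @bounded_cvg_ultra _ _ U u (`|u 0| + K * T).
  apply: TU; apply: filterS nearT => t tT.
  rewrite -[u t](subrK (u 0)) addrC; apply: le_trans (ler_normD _ _) _; rewrite lerD2l.
  have z0 : 0 <= (0 : R) < T by rewrite lexx T0.
  apply: le_trans (lip t 0 tT z0) _; rewrite subr0 ler_wpM2l//.
  by case/andP: tT => t0 /ltW tT; rewrite ger0_norm.
have le t : 0 <= t < T -> `|u t - l| <= K * `|t - T|.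
  move=> tT.
  have c1 : (`|u t - u s|) @[s --> U] --> `|u t - l|.
    by apply: cvg_norm; apply: cvgB => //; exact: cvg_cst.
  have c2 : K * `|t - s| @[s --> U] --> K * `|t - T|.
    apply: cvgM; first exact: cvg_cst.
    apply: cvg_norm; apply: cvgB; first exact: cvg_cst.
    apply: cvg_trans (_ : id @ T^'- --> T); first by move=> A /TU.
    exact: cvg_within.
  rewrite -(cvg_lim _ c1)// -(cvg_lim _ c2)//.
  apply: ler_lim; [exact: cvgP c1|exact: cvgP c2|].
  by apply: TU; apply: filterS nearT => s sT; exact: lip.
have cT : id @ T^'- --> T by exact: cvg_within.
exists l; apply/cvgrPdist_le => e e0.
have eK : 0 < e / (K + 1) by rewrite divr_gt0// ltr_wpDl.
move/cvgrPdist_le : cT => /(_ _ eK) cT; near=> t.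
have tT : 0 <= t < T by near: t.
rewrite distrC; apply: le_trans (le t tT) _.
have : `|T - t| <= e / (K + 1) by near: t.
rewrite ler_pdivlMr ?ltr_wpDl// distrC mulrDr mulr1 mulrC.
by have := normr_ge0 (t - T); lra.
Unshelve. all: by end_near. Qed.

Lemma scalar_primitive_cvg T (u v : R -> R) t : scalar_primitive T u v ->
  0 < t -> (t%:E < T)%E -> {for t, continuous u}.
Proof.
by move=> [_ du] t0 /(du _ t0)[ut _]; exact/differentiable_continuous/derivable1_diffP.
Qed.

(** The solution has a limit at [T], from which a local solution is restarted. The glued function is
    continuous at [T], hence so is its rate by continuity of [F], and differentiability at [T]
    follows. *)
Lemma solution_extension (T K : R) y : 0 < T -> coord_solution T%:E y ->
  (forall t a, 0 < t < T -> `|F (y t) a| <= K) ->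
  exists2 T' : R, T < T' & exists2 w, coord_solution T'%:E w &
    forall t, t < T -> w t = y t.
Proof.
move=> T0 yF FK.
have lim a : exists l : R, (y^~ a) @ T^'- --> l.
  by apply: (left_limit (K := K) T0 (yF a)) => t tT; exact: FK.
pose z a : R := xget 0 [set l | (y^~ a) @ T^'- --> l].
have yz a : (y^~ a) @ T^'- --> z a.
  by case: (lim a) => l hl; rewrite /z; case: xgetP => [l' -> //|/(_ l)].
have [tau tau0 [v v0 vF]] := peano_local z.
pose w t := if t < T then y t else v (t - T).
have wy t : t < T -> w t = y t by rewrite /w => ->.
have wv t : T <= t -> w t = v (t - T) by rewrite /w ltNge => ->.
exists (T + tau); first by rewrite ltrDl.
exists w; last exact: wy.
have wT : w T = z by rewrite wv// subrr v0.
have near_y t : t < T -> \forall s \near t, w s = y s.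
  by move=> tT; near=> s; apply: wy; near: s; exact: lt_nbhsl.
have near_v t : T < t -> \forall s \near t, w s = v (s - T).
  by move=> tT; near=> s; apply: wv; apply: ltW; near: s; exact: lt_nbhsr.
have cwT a : {for T, continuous (w^~ a)}.
  apply/left_right_continuousP; split.
    rewrite wT; apply: cvg_trans (yz a); apply: near_eq_cvg; near=> s.
    by rewrite /= wy//; near: s; exact: nbhs_left_lt.
  rewrite wT -v0.
  have c0 : horizon tau%:E (0 : R) by split; rewrite ?lte_fin.
  have := (vF a).1 0 c0 => cv.
  suff : v (s - T) a @[s --> T^'+] --> v 0 a.
    apply: cvg_trans; apply: near_eq_cvg; near=> s.
    by rewrite /= wv//; near: s; exact: nbhs_right_ge.
  apply: (cvg_comp _ (v^~ a)) cv.
  move=> A; rewrite /within /= => A0.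
  have cs : (s - T) @[s --> T^'+] --> (0 : R).
    rewrite -(subrr T); apply: cvgB; last exact: cvg_cst.
    exact: cvg_within.
  have := cs _ A0; rewrite /= => H; near=> s.
  have : horizon tau%:E (s - T).
    split; first by rewrite subr_ge0; near: s; exact: nbhs_right_ge.
    rewrite lte_fin ltrBlDl; near: s; apply: nbhs_right_lt; by rewrite ltrDl.
  by near: s.
have dw_off a t : 0 < t -> t < T + tau -> t != T ->
    is_derive t 1 (w^~ a) (F (w t) a).
  move=> t0 tT; rewrite neq_lt => /orP[tT'|Tt].
    rewrite wy//; apply: (@near_eq_is_derive _ _ _ (y^~ a)).
      by apply: filterS (near_y t tT') => s ->.
    by apply: (yF a).2.
  rewrite wv ?ltW//; apply: (@near_eq_is_derive _ _ _ ((v^~ a) \o (fun s => s - T))).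
    by apply: filterS (near_v t Tt) => s ->.
  rewrite -[F _ _]mulr1; apply: is_derive1_comp.
    by apply: (vF a).2; rewrite ?subr_gt0// lte_fin ltrBlDl.
  by apply: is_derive_eq; rewrite subr0.
have cw a t : 0 < t -> t < T + tau -> {for t, continuous (w^~ a)}.
  move=> t0 tT; have [->|tT'] := eqVneq t T; first exact: cwT.
  have [+ _] := dw_off a t t0 tT tT'.
  by move=> ?; exact/differentiable_continuous/derivable1_diffP.
move=> a; split.
  move=> t [t0]; rewrite lte_fin => tT.
  move: t0; rewrite le_eqVlt => /predU1P[<-|t0]; last first.
    by apply: cvg_within_filter; exact: cw.
  have h0 : horizon T%:E (0 : R) by split; rewrite ?lte_fin.
  have := (yF a).1 0 h0; rewrite -wy// => cy0.
  move=> A A0; have H : \forall s \near (0 : R), horizon T%:E s -> A (y s a) := cy0 A A0.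
  suff : \forall s \near (0 : R), horizon (T + tau)%:E s -> A (w s a) by [].
  near=> s => sT.
  have sT' : s < T by near: s; exact: lt_nbhsl.
  rewrite wy//; have : horizon T%:E s by split; [exact: sT.1|rewrite lte_fin].
  by near: s.
move=> t t0; rewrite lte_fin => tT.
have [tE|tT'] := eqVneq t T; last exact: dw_off.
rewrite tE; apply: (@is_derive_limit _ _ (fun t => F (w t) a)); first exact: cwT.
  near=> s => sT; apply: dw_off => //.
    by near: s; exact: lt_nbhsr.
  by near: s; apply: lt_nbhsl; rewrite ltrDl.
apply: cvg_within_filter.
apply: (F_cont (G := nbhs T)) => b; exact: cwT.
Unshelve. all: by end_near. Qed.

End continuation.

(** * Farkas' lemma *)

Section farkas.
Variables (R : realFieldType) (W : lmodType R).

Definition functional (a : W -> R) := forall k x y, a (k *: x + y) = k * a x + a y.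

Lemma functional0 a : functional a -> a 0 = 0.
Proof. by move=> la; have := la (-1) 0 0; rewrite scaler0 addr0; lra. Qed.

Lemma functionalZ a k x : functional a -> a (k *: x) = k * a x.
Proof. by move=> la; rewrite -[k *: x]addr0 la functional0// addr0. Qed.

(* Bartl's induction: if dropping [j] breaks the implication, some [x0] has
   [a j x0 < 0], and projecting along [x0] onto the kernel of [a j] removes [j]. *)
Lemma farkas (J : eqType) (s : seq J) (a : J -> W -> R) (c : W -> R) : uniq s ->
  (forall j, functional (a j)) -> functional c ->
  (forall x, (forall j, j \in s -> 0 <= a j x) -> 0 <= c x) ->
  exists2 u : J -> R, forall j, 0 <= u j & forall x, c x = \sum_(j <- s) u j * a j x.
Proof.
elim: s a c => [|k s IH] a c.
  move=> _ _ lc c0; exists (fun=> 0) => // x; rewrite big_nil.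
  have c_ge0 y : 0 <= c y by exact: c0.
  have := c_ge0 (-1 *: x); rewrite functionalZ// mulN1r oppr_ge0 => cx.
  by apply/le_anti; rewrite cx c_ge0.
move=> /= /andP[ks us] la lc c0.
have [c0'|] := pselect (forall x, (forall j, j \in s -> 0 <= a j x) -> 0 <= c x).
  have [u u0 cu] := IH a c us la lc c0'.
  exists (fun j => if j == k then 0 else u j) => [j|x]; first by case: ifP.
  rewrite big_cons eqxx mul0r add0r cu; apply: eq_big_seq => j js.
  by case: eqP => // jk; rewrite -jk js in ks.
move=> /existsNP[x0 /not_implyP[ax0 /negP]]; rewrite -ltNge => cx0.
have ak : a k x0 < 0.
  rewrite ltNge; apply/negP => ak; suff : 0 <= c x0 by rewrite leNgt cx0.
  by apply: c0 => j; rewrite inE => /predU1P[->|/ax0].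
(* Normalised so that [a k y0 = -1]: adding [a k x *: y0] to [x] lands in the kernel of [a k]. *)
pose y0 := (- (a k x0)^-1) *: x0.
have ay0 : a k y0 = -1 by rewrite functionalZ// mulNr mulVf ?lt_eqF.
have sc : 0 <= - (a k x0)^-1 by rewrite oppr_ge0 invr_le0 ltW.
have cy0 : c y0 <= 0 by rewrite functionalZ// mulr_ge0_le0// ltW.
have aj0 j : j \in s -> 0 <= a j y0 by move=> js; rewrite functionalZ// mulr_ge0// ax0.
pose pr (b : W -> R) x := b x + a k x * b y0.
have lpr b : functional b -> functional (pr b).
  by move=> lb t x y; rewrite /pr lb la; ring.
have prE b x : functional b -> pr b x = b (a k x *: y0 + x).
  by move=> lb; rewrite /pr lb addrC.
have [||x hx|u u0 cu] := IH (fun j => pr (a j)) (pr c) us.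
- by move=> j; apply: lpr.
- exact: lpr.
- rewrite prE//; apply: c0 => j; rewrite inE => /predU1P[->|js].
    by rewrite la ay0 mulrN1 addNr.
  by rewrite -prE// hx.
(* Expanding [pr c] and the [pr (a j)] leaves this coefficient in front of [a k x]. It is
   nonnegative because [c y0 <= 0 <= a j y0], and [k] is not in [s], so no other term is
   overwritten. *)
exists (fun j => if j == k then (\sum_(j <- s) u j * a j y0) - c y0 else u j).
  move=> j; case: ifP => // _; rewrite subr_ge0 (le_trans cy0)//.
  by rewrite big_seq sumr_ge0// => i /aj0 ?; rewrite mulr_ge0.
move=> x; rewrite big_cons eqxx.
have -> : \sum_(j <- s) (if j == k then (\sum_(j <- s) u j * a j y0) - c y0 else u j) * a j
  x
    = \sum_(j <- s) u j * a j x.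
  apply: eq_big_seq => j js.
  by case: eqP => // jk; rewrite -jk js in ks.
have := cu x; rewrite /pr; under eq_bigr do rewrite mulrDr mulrCA.
by rewrite big_split/= -mulr_sumr; lra.
Qed.

End farkas.

(** * Gradients of convex functions, graph Laplacians *)

Section dot.
Variables (R : realType) (n : nat).
Implicit Types (u v w : 'cV[R]_n) (a : R).

Definition dot u v : R := \sum_j u j 0 * v j 0.

Lemma dotC u v : dot u v = dot v u.
Proof. by apply: eq_bigr => j _; rewrite mulrC. Qed.

Lemma dotDl u v w : dot (u + v) w = dot u w + dot v w.
Proof. by rewrite -big_split; apply: eq_bigr => j _; rewrite mxE mulrDl. Qed.

Lemma dotZl a u v : dot (a *: u) v = a * dot u v.
Proof. by rewrite mulr_sumr; apply: eq_bigr => j _; rewrite mxE mulrA. Qed.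

Lemma dotNl u v : dot (- u) v = - dot u v.
Proof. by rewrite -scaleN1r dotZl mulN1r. Qed.

Lemma dotBl u v w : dot (u - v) w = dot u w - dot v w.
Proof. by rewrite dotDl dotNl. Qed.

Lemma dotDr u v w : dot w (u + v) = dot w u + dot w v.
Proof. by rewrite dotC dotDl ![dot _ w]dotC. Qed.

Lemma dotZr a u v : dot v (a *: u) = a * dot v u.
Proof. by rewrite dotC dotZl dotC. Qed.

Lemma dotNr u v : dot u (- v) = - dot u v.
Proof. by rewrite dotC dotNl dotC. Qed.

Lemma dotBr u v w : dot w (u - v) = dot w u - dot w v.
Proof. by rewrite dotDr dotNr. Qed.

Lemma dot0l v : dot 0 v = 0.
Proof. by rewrite -(scale0r 0) dotZl mul0r. Qed.

Lemma dot_suml (J : finType) (P : pred J) (u : J -> 'cV[R]_n) v :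
  dot (\sum_(j | P j) u j) v = \sum_(j | P j) dot (u j) v.
Proof. by rewrite (big_morph (dot^~ v) (fun x y => dotDl x y v) (dot0l v)). Qed.

Lemma dot_ge0 u : 0 <= dot u u.
Proof. by apply: sumr_ge0 => j _; rewrite -expr2 sqr_ge0. Qed.

Lemma dot_eq0 u : dot u u = 0 -> u = 0.
Proof.
move/eqP; rewrite psumr_eq0 => [/allP u0|j _]; last by rewrite -expr2 sqr_ge0.
apply/colP => j; have := u0 j (mem_index_enum _).
by rewrite mxE mulf_eq0 orbb => /eqP.
Qed.

Lemma dot_coord u j : u j 0 ^+ 2 <= dot u u.
Proof. by rewrite /dot (bigD1 j)//= lerDl sumr_ge0// => i _; rewrite -expr2 sqr_ge0. Qed.

End dot.

Section gradient.
Variables (R : realType) (n : nat).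
Implicit Types (f : 'cV[R]_n -> R) (x y z d : 'cV[R]_n).

Lemma derive_grad f z d : differentiable f z -> 'D_d f z = dot (grad f z) d.
Proof.
move=> df; rewrite deriveE//.
have {1}-> : d = \sum_j d j 0 *: delta_mx j 0.
  rewrite {1}(matrix_sum_delta d); apply: eq_bigr => j _; by rewrite big_ord1.
rewrite raddf_sum; apply: eq_bigr => j _.
transitivity (d j 0 *: ('d f z (delta_mx j 0) : R^o)); first exact: linearZ.
by rewrite mxE deriveE// mulrC.
Qed.

Lemma right_derivative f z d : differentiable f z ->
  t^-1 * (f (t *: d + z) - f z) @[t --> (0 : R)^'+] --> dot (grad f z) d.
Proof.
move=> df; rewrite -derive_grad//.
have /cvg_ex[/= l fl] : derivable f z d by exact: diff_derivable.
have -> : 'D_d f z = l by apply: cvg_lim fl.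
rewrite /at_right; apply: cvg_withinS fl => t /= t0; by rewrite gt_eqF.
Qed.

Lemma right_derivative_ge f z d a : differentiable f z ->
  (\forall t \near (0 : R)^'+, t * a <= f (t *: d + z) - f z) -> a <= dot (grad f z) d.
Proof.
move=> df H; have fl := @right_derivative f z d df.
rewrite -(cvg_lim _ fl)//; apply: limr_ge; first exact: cvgP fl.
near=> t; have t0 : 0 < t by [].
by rewrite ler_pdivlMl//; near: t.
Unshelve. all: by end_near. Qed.

Lemma descent_direction f z d : differentiable f z -> dot (grad f z) d < 0 ->
  \forall t \near (0 : R)^'+, f (t *: d + z) < f z.
Proof.
move=> df d0; have fl := @right_derivative f z d df.
have d2 : 0 < - dot (grad f z) d by lra.
move/cvgrPdist_lt : fl => /(_ _ d2) H; near=> t.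
have t0 : 0 < t by [].
have : `|dot (grad f z) d - t^-1 * (f (t *: d + z) - f z)| < - dot (grad f z) d by near: t.
rewrite ltr_norml => /andP[+ _].
rewrite opprK ltrBrDr -ltrBrDl subrr ltNge pmulr_rge0 ?invr_gt0// -ltNge; lra.
Unshelve. all: by end_near. Qed.

Definition bregman f y x := f y - f x - dot (grad f x) (y - x).

Lemma bregman_ge0 f y x : convex_function setT f -> differentiable f x ->
  0 <= bregman f y x.
Proof.
move=> fc df; rewrite subr_ge0.
suff : - (f y - f x) <= - dot (grad f x) (y - x) by rewrite lerN2.
have fl := @right_derivative f x (y - x) df.
rewrite lerN2 -(cvg_lim _ fl)//; apply: limr_le; first exact: cvgP fl.
near=> t; have t0 : 0 < t by [].
have t1 : t <= 1 by near: t; exact: nbhs_right_le.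
rewrite ler_pdivrMl//.
have t01 : 0 <= t <= 1 by rewrite t1 ltW.
have := fc (Itv01 (ltW t0) t1) y x; rewrite !inE => /(_ Logic.I Logic.I).
rewrite convRE /conv /= /unstable.onem => le.
have -> : t *: (y - x) + x = t *: y + (1 - t) *: x.
  by rewrite scalerBr scalerBl scale1r addrAC -addrA.
lra.
Unshelve. all: by end_near. Qed.

Lemma bregman_sym f x y :
  dot (grad f x - grad f y) (x - y) = bregman f y x + bregman f x y.
Proof. by rewrite /bregman -[y - x]opprB dotNr dotBl; lra. Qed.

(** The tangent plane at [y] supports [f] and touches its graph at [x], so [f] minus this affine
    function is minimal at [x]. Without strict convexity, equality of gradients is all that can be
    concluded. *)
Lemma bregman_eq0 f x y : convex_function setT f -> (forall z, differentiable f z) ->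
  bregman f x y = 0 -> grad f x = grad f y.
Proof.
move=> fc df b0; apply/eqP; rewrite -subr_eq0; apply/eqP/dot_eq0/le_anti.
rewrite dot_ge0 andbT.
suff : forall d, dot (grad f y) d <= dot (grad f x) d.
  by move=> /(_ (- (grad f x - grad f y))); rewrite !dotNr dotBl; lra.
move=> d; apply: right_derivative_ge => //; apply: nearW => t.
have := bregman_ge0 (t *: d + x) fc (df y); move: b0; rewrite /bregman.
have -> : t *: d + x - y = t *: d + (x - y) by rewrite addrA.
by rewrite [dot _ (_ *: _ + _)]dotDr dotZr; lra.
Qed.

End gradient.

Section affine.
Variables (R : realType) (n : nat).

Lemma affine_grad (h : 'cV[R]_n -> R) : affine_function h ->
  exists a, (forall z, grad h z = a) /\ forall x y, h x - h y = dot a (x - y).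
Proof.
move=> [a [c hE]]; exists a^T.
have hB x y : h x - h y = dot a^T (x - y).
  rewrite !hE opprD addrACA subrr addr0 !mxE -sumrB; apply: eq_bigr => j _.
  by rewrite !mxE mulrBr.
split=> // z; apply/colP => j; rewrite mxE.
have dE d : 'D_d h z = dot a^T d.
  apply: cvg_lim => //; rewrite -[X in _ --> X]/(dot a^T d).
  apply: (@cvg_trans _ ((fun=> dot a^T d) @ (0 : R)^')); last exact: cvg_cst.
  apply: near_eq_cvg; near=> t; rewrite /= hB addrK dotZr.
  rewrite /GRing.scale /= mulKf//; near: t; exact: nbhs_dnbhs_neq.
rewrite dE /dot (bigD1 j)//= [delta_mx _ _ _ _]mxE !eqxx mulr1 big1 ?addr0// => i ij.
by rewrite [delta_mx _ _ _ _]mxE (negbTE ij) mulr0.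
Unshelve. all: by end_near. Qed.

End affine.

(** * The graph Laplacian and its energy *)

Section graph.
Variables (R : realType) (N n : nat) (E : rel 'I_N) (A : 'M[R]_N).
Hypothesis A_adjacency : adjacency_matrix E A.
Implicit Types x y : 'I_N -> 'cV[R]_n.

(** Block [i] of minus the Laplacian, the sign with which it enters the dynamics. *)
Definition lap x i := \sum_j A i j *: (x j - x i).

Lemma edge_sum x i : \sum_(j | E i j) A i j *: (x j - x i) = lap x i.
Proof.
have [_ _ _ A0] := A_adjacency.
rewrite /lap [RHS](bigID (E i)) /= [X in _ + X]big1 ?addr0// => j /A0 ->.
by rewrite scale0r.
Qed.

Lemma lapD k x y i : lap (fun j => k *: x j + y j) i = k *: lap x i + lap y i.
Proof.
rewrite /lap scaler_sumr -big_split; apply: eq_bigr => j _ /=.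
rewrite [k *: (_ *: _)]scalerA [k * _]mulrC -scalerA -[RHS]scalerDr.
by congr (_ *: _); rewrite scalerBr opprD addrACA.
Qed.

Lemma lapB x y i : lap (fun j => x j - y j) i = lap x i - lap y i.
Proof.
have := lapD (-1) y x i; rewrite scaleN1r addrC => <-; congr lap; apply/funext => j.
by rewrite scaleN1r addrC.
Qed.

Lemma lap_sym x y : \sum_i dot (lap x i) (y i) = \sum_i dot (x i) (lap y i).
Proof.
have [_ AC _ _] := A_adjacency.
have expand u v : \sum_i dot (lap u i) (v i) =
    \sum_i \sum_j A i j * dot (u j) (v i) - \sum_i \sum_j A i j * dot (u i) (v i).
  rewrite -sumrB; apply: eq_bigr => i _; rewrite dot_suml -sumrB.
  by apply: eq_bigr => j _; rewrite dotZl dotBl mulrBr.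
have -> : \sum_i dot (x i) (lap y i) = \sum_i dot (lap y i) (x i).
  by apply: eq_bigr => i _; exact: dotC.
rewrite !expand; congr (_ - _).
  rewrite exchange_big; apply: eq_bigr => i _; apply: eq_bigr => j _.
  by rewrite AC dotC.
by apply: eq_bigr => i _; apply: eq_bigr => j _; rewrite dotC.
Qed.

Definition disagreement x : R := \sum_i \sum_j A i j * dot (x j - x i) (x j - x i).

(** Exchanging the two indices gives a second expression of the same sum; adding both turns every
    edge term into a square. *)
Lemma lap_energy x : \sum_i dot (x i) (lap x i) = - (disagreement x / 2).
Proof.
have [_ AC _ _] := A_adjacency.
have e1 : \sum_i dot (x i) (lap x i) = \sum_i \sum_j A i j * dot (x j - x i) (x i).
  by apply: eq_bigr => i _; rewrite dotC dot_suml; apply: eq_bigr => j _; rewrite dotZl.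
have e2 : \sum_i dot (x i) (lap x i) = - \sum_i \sum_j A i j * dot (x j - x i) (x j).
  rewrite e1 exchange_big -sumrN; apply: eq_bigr => i _.
  rewrite -sumrN; apply: eq_bigr => j _.
  by rewrite AC -opprB dotNl mulrN.
suff : 2 * \sum_i dot (x i) (lap x i) = - disagreement x by lra.
rewrite mulr_natl mulr2n {1}e1 e2 /disagreement -sumrB -sumrN.
apply: eq_bigr => i _; rewrite -sumrB -sumrN; apply: eq_bigr => j _.
by rewrite dotBr; ring.
Qed.

Lemma disagreement_ge0 x : 0 <= disagreement x.
Proof.
have [_ _ Ap A0] := A_adjacency.
apply: sumr_ge0 => i _; apply: sumr_ge0 => j _; rewrite mulr_ge0 ?dot_ge0//.
by have [/Ap/ltW//|/A0 ->] := boolP (E i j).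
Qed.

Lemma disagreement_eq0 x : connected_graph E -> disagreement x = 0 ->
  forall i j, x i = x j.
Proof.
move=> Ec; have [_ _ Ap A0] := A_adjacency.
have A_ge0 i j : 0 <= A i j * dot (x j - x i) (x j - x i).
  by rewrite mulr_ge0 ?dot_ge0//; have [/Ap/ltW//|/A0 ->] := boolP (E i j).
move/eqP; rewrite psumr_eq0 => [/allP d0|i _]; last by apply: sumr_ge0.
have step i j : E i j -> x j = x i.
  move=> ij; have := d0 i (mem_index_enum _); rewrite /= psumr_eq0//.
  move=> /allP/(_ j (mem_index_enum _)) /=; rewrite mulf_eq0 gt_eqF ?Ap//=.
  by move/eqP/dot_eq0/eqP; rewrite subr_eq0 => /eqP.
move=> i j; have /connectP[p + ->] := Ec i j.
by elim: p i => [//|k p IH] i /= /andP[/step <- /IH].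
Qed.

Lemma lap_eq0 x : connected_graph E -> (forall i, lap x i = 0) ->
  forall i j, x i = x j.
Proof.
move=> Ec x0; apply: disagreement_eq0 => //.
have := lap_energy x; rewrite big1 => [|i _]; last by rewrite x0 dotC dot0l.
lra.
Qed.

Lemma lap_cst x : (forall i j, x i = x j) -> forall i, lap x i = 0.
Proof. by move=> xE i; rewrite /lap big1// => j _; rewrite (xE j i) subrr scaler0. Qed.

End graph.

(** * Karush-Kuhn-Tucker multipliers *)

Section kkt.
Variables (R : realType) (N n : nat).
Variables (f g h : 'I_N -> 'cV[R]_n -> R) (E : rel 'I_N) (A : 'M[R]_N).
Hypothesis f_diff : forall i z, differentiable (f i) z.
Hypothesis g_diff : forall i z, differentiable (g i) z.
Hypothesis g_convex : forall i, convex_function setT (g i).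
Hypothesis h_affine : forall i, affine_function (h i).
Hypothesis slater_cond : slater g h.

(* Tilting [d] towards a Slater point makes the active constraints strictly decrease. *)
Lemma optimal_direction z d : common_optimal f g h z ->
  (forall i, dot (grad (h i) z) d = 0) ->
  (forall i, g i z = 0 -> dot (grad (g i) z) d <= 0) ->
  0 <= \sum_i dot (grad (f i) z) d.
Proof.
move=> [zfeas zmin] hd gd; rewrite leNgt; apply/negP => fd.
have [y yS] := slater_cond.
set a := \sum_i _ in fd; pose B := \sum_i dot (grad (f i) z) (y - z).
(* The tilt costs at most [e * (|B| + 1) = - a / 2], half of the assumed decrease. *)
pose e := - a / (2 * (`|B| + 1)).
have B0 : 0 < `|B| + 1 by rewrite ltr_wpDl.
have e0 : 0 < e by rewrite divr_gt0 ?mulr_gt0 ?oppr_gt0.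
have eB : a + e * B < 0.
  have : e * (`|B| + 1) = - a / 2.
    by rewrite /e; field; rewrite gt_eqF.
  have := ler_wpM2l (ltW e0) (ler_norm B); lra.
pose D := d + e *: (y - z).
pose F := \sum_i f i.
have FE w : F w = \sum_i f i w by rewrite /F fct_sumE.
have dF : differentiable F z by apply: differentiable_sum => i.
have FD : dot (grad F z) D < 0.
  rewrite -derive_grad// derive_sum; last by move=> i; exact: diff_derivable.
  under eq_bigr do rewrite derive_grad// dotDr dotZr.
  by rewrite big_split/= -mulr_sumr.
have decr := descent_direction dF FD.
have gD : \forall t \near (0 : R)^'+, forall i, g i (t *: D + z) <= 0.
  apply: filter_forall => i.
  have [gi0|gi0] := eqVneq (g i z) 0; last first.
    have giz : g i z < 0 by rewrite lt_neqAle gi0; case: (zfeas i).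
    have c : g i (t *: D + z) @[t --> (0 : R)^'+] --> g i z.
      have cg : {for z, continuous (g i)} by exact: differentiable_continuous.
      suff cz : (t *: D + z) @[t --> (0 : R)^'+] --> z by exact: (cvg_comp _ _ cz cg).
      have : (t *: D + z) @[t --> (0 : R)] --> (0 : R) *: D + z.
        by apply: cvgD; [apply: cvgZr_tmp|exact: cvg_cst].
      by rewrite scale0r add0r => cz; apply: cvg_within_filter.
    have ng : 0 < - g i z by lra.
    move/cvgrPdist_lt : c => /(_ _ ng); apply: filterS => t.
    by rewrite ltr_norml => /andP[? ?]; lra.
  have : dot (grad (g i) z) D < 0.
    rewrite /D dotDr dotZr; have := gd i gi0.
    have := bregman_ge0 y (g_convex i) (g_diff i z); rewrite /bregman gi0 subr0.
    have [gy _] := yS i => b1 b2.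
    have : e * dot (grad (g i) z) (y - z) < 0 by rewrite pmulr_rlt0//; lra.
    lra.
  move/(descent_direction (g_diff i z)); apply: filterS => t; rewrite gi0; exact: ltW.
have [t [Ft gt]] := filter_ex (filterI decr gD).
have : F z <= F (t *: D + z).
  rewrite !FE; apply: zmin => i; split=> //.
  have [a' [aE hB]] := affine_grad (h_affine i).
  have [_ hz] := zfeas i; have [_ hy] := yS i.
  have := hB (t *: D + z) z; rewrite hz subr0 addrK dotZr /D dotDr dotZr -hB hz hy.
  by rewrite -(aE z) hd subr0 mulr0 addr0 mulr0.
by rewrite leNgt Ft.
Qed.

Hypothesis A_adjacency : adjacency_matrix E A.
Hypothesis E_connected : connected_graph E.

(** Farkas' lemma is applied to families of directions, one per agent. The constraint that [lap A d]
    vanishes forces a common direction by connectedness, which reduces to [optimal_direction], and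
    its multipliers are the [xi]. Equalities are encoded as two inequalities indexed by a sign [s];
    inactive inequalities become the zero functional. *)
Lemma kkt z : common_optimal f g h z ->
  exists (xi : 'I_N -> 'cV[R]_n) (lam mu : 'I_N -> R),
    [/\ forall i, 0 <= lam i, forall i, lam i * g i z = 0 &
    forall i, - grad (f i) z - lam i ^+ 2 *: grad (g i) z - mu i *: grad (h i) z
      - lap A xi i = 0].
Proof.
move=> zopt; pose W := 'I_N -> 'cV[R]_n.
pose J := ('I_N + ('I_N * bool) + ('I_N * 'I_n * bool))%type.
pose a (j : J) (d : W) : R := match j with
  | inl (inl i) => (g i z == 0)%:R * - dot (grad (g i) z) (d i)
  | inl (inr (i, s)) => (-1) ^+ s * dot (grad (h i) z) (d i)
  | inr (i, k, s) => (-1) ^+ s * lap A d i k 0 end.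
have la j : functional (a j).
  move=> k x y; case: j => [[i|[i s]]|[[i l] s]] /=.
  - by rewrite dotDr dotZr; ring.
  - by rewrite dotDr dotZr; ring.
  - have -> : lap A (k *: x + y) i = k *: lap A x i + lap A y i by exact: lapD.
    by rewrite !mxE; ring.
pose c (d : W) := \sum_i dot (grad (f i) z) (d i).
have lc : functional c.
  move=> k x y; rewrite /c mulr_sumr -big_split; apply: eq_bigr => i _ /=.
  by rewrite dotDr dotZr.
have [|u u0 cu] := farkas (index_enum_uniq J) la lc.
  move=> d ad.
  have {}ad j : 0 <= a j d by apply: ad; exact: mem_index_enum.
  have sgn (x : R) : (forall s : bool, 0 <= (-1) ^+ s * x) -> x = 0.
    by move=> H; have := H true; have := H false; rewrite expr0 expr1; lra.
  have dE : forall i j, d i = d j.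
    apply: (lap_eq0 A_adjacency E_connected) => i; apply/colP => k; rewrite [RHS]mxE.
    by apply: sgn => s; have := ad (inr (i, k, s)).
  case: (pickP 'I_N) => [i0 _|N0]; last by rewrite /c big1// => i; have := N0 i.
  have -> : c d = \sum_i dot (grad (f i) z) (d i0).
    by apply: eq_bigr => i _; rewrite (dE i i0).
  apply: optimal_direction => // i => [|gi0]; rewrite (dE i0 i).
    by apply: sgn => s; have := ad (inl (inr (i, s))).
  by have := ad (inl (inl i)); rewrite /= gi0 eqxx mul1r oppr_ge0.
(* The dynamics contains [lam ^+ 2], whence the square root; the indicator gives complementary
   slackness. *)
pose lam i := Num.sqrt (u (inl (inl i)) * (g i z == 0)%:R).
have lam2 i : lam i ^+ 2 = u (inl (inl i)) * (g i z == 0)%:R.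
  by rewrite sqr_sqrtr// mulr_ge0.
pose mu i := \sum_(s : bool) - (u (inl (inr (i, s))) * (-1) ^+ s).
pose xi i : 'cV[R]_n := \col_k \sum_(s : bool) - (u (inr (i, k, s)) * (-1) ^+ s).
exists xi, lam, mu; split=> [i|i|]; first exact: sqrtr_ge0.
  by rewrite /lam; case: eqP => [->|_]; rewrite ?mulr0// sqrtr0 mul0r.
pose X i := - grad (f i) z - lam i ^+ 2 *: grad (g i) z - mu i *: grad (h i) z - lap A xi i.
have T1 d : \sum_i u (inl (inl i)) * a (inl (inl i)) d =
    - \sum_i lam i ^+ 2 * dot (grad (g i) z) (d i).
  by rewrite -sumrN; apply: eq_bigr => i _; rewrite lam2 /=; ring.
have T2 d : \sum_(p : 'I_N * bool) u (inl (inr p)) * a (inl (inr p)) d =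
    - \sum_i mu i * dot (grad (h i) z) (d i).
  transitivity (\sum_i \sum_s u (inl (inr (i, s))) * a (inl (inr (i, s))) d).
    by rewrite pair_bigA; apply: eq_bigr => -[].
  rewrite -sumrN; apply: eq_bigr => i _; rewrite mulr_suml -sumrN.
  by apply: eq_bigr => s _ /=; ring.
have T3 d : \sum_(p : 'I_N * 'I_n * bool) u (inr p) * a (inr p) d =
    - \sum_i dot (xi i) (lap A d i).
  transitivity (\sum_i \sum_k \sum_s u (inr (i, k, s)) * a (inr (i, k, s)) d).
    by rewrite pair_bigA pair_bigA; apply: eq_bigr => -[[]].
  rewrite -sumrN; apply: eq_bigr => i _; rewrite -sumrN.
  apply: eq_bigr => k _; rewrite mxE mulr_suml -sumrN.
  by apply: eq_bigr => s _ /=; ring.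
have key d : \sum_i dot (X i) (d i) = 0.
  under eq_bigr do rewrite !dotBl dotNl !dotZl.
  rewrite !sumrB sumrN -/(c d) (lap_sym A_adjacency) cu !big_sumType /= T1 T2 T3.
  by ring.
(* The residual [X] is orthogonal to every family, in particular to itself. *)
have := key X; move/eqP; rewrite psumr_eq0 => [/allP X0 i|i _]; last exact: dot_ge0.
by apply: dot_eq0; apply/eqP; exact: X0 (mem_index_enum i).
Qed.

End kkt.

(** * The state space in coordinates *)

Section limits.
Variables (R : realType) (V : normedModType R).
Variables (T : Type) (G : set_system T).
Hypothesis FG : Filter G.

Lemma cvg_sum (J : finType) (P : pred J) (u : J -> T -> V) (l : J -> V) :
  (forall j, P j -> u j @ G --> l j) ->
  (fun t => \sum_(j | P j) u j t) @ G --> \sum_(j | P j) l j.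
Proof. by move=> ul; apply: cvg_big => //; exact: add_continuous. Qed.

Lemma cvg_scale (u : T -> V) (a : R) (l : V) :
  u @ G --> l -> (fun t => a *: u t) @ G --> a *: l.
Proof. by move=> ul; apply: cvgZ => //; exact: cvg_cst. Qed.

End limits.

Section columns.
Variables (R : realType) (n : nat).

Lemma cvg_colP (T : Type) (G : set_system T) (u : T -> 'cV[R]_n) (l : 'cV[R]_n) :
  Filter G -> u @ G --> l <-> forall j, (fun t => u t j 0) @ G --> l j 0.
Proof.
move=> FG; split=> [ul j|ul].
  exact: (cvg_comp _ (fun M : 'cV[R]_n => M j 0) ul (@coord_continuous R n 1 j 0 l)).
apply/cvgrPdist_le => e e0; near=> t.
rewrite [leLHS]/Num.Def.normr/= mx_normrE (bigmax_le _ (ltW e0))//= => -[j k] _.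
rewrite !mxE (ord1 k) /=; move: j; near: t; apply: filter_forall => j.
by have /cvgrPdist_le := ul j; apply.
Unshelve. all: by end_near. Qed.

Lemma cvg_dot (T : Type) (G : set_system T) (u v : T -> 'cV[R]_n) (k l : 'cV[R]_n) :
  Filter G -> u @ G --> k -> v @ G --> l -> (fun t => dot (u t) (v t)) @ G --> dot k l.
Proof.
move=> FG /cvg_colP uk /cvg_colP vl; apply: (@cvg_sum R R^o) => j _.
by apply: cvgM; [exact: uk|exact: vl].
Qed.

Lemma is_derive_colP (u : R -> 'cV[R]_n) (t : R) (v : 'cV[R]_n) :
  is_derive t 1 u v <-> forall j, is_derive t 1 (fun s => u s j 0) (v j 0).
Proof.
split=> [[du <-] j|uv].
  have duj : derivable (fun s => u s j 0) t 1 by exact: (derivable_mxP u t 1).1.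
  by apply: DeriveDef => //; rewrite derive_mx// mxE.
have du : derivable u t 1 by apply/derivable_mxP => i j; rewrite (ord1 j); case: (uv i).
apply: DeriveDef => //; rewrite derive_mx//; apply/colP => j; rewrite mxE.
by case: (uv j) => _ <-.
Qed.

Lemma primitive_on_colP T (u v : R -> 'cV[R]_n) :
  primitive_on T u v <->
  forall j, scalar_primitive T (fun t => u t j 0) (fun t => v t j 0).
Proof.
split=> [[/subspace_continuousP cu du] j|uv].
  split=> [t tT|t t0 tT]; first by have /cvg_colP := cu t tT; apply.
  by have /is_derive_colP := du t t0 tT; apply.
split=> [|t t0 tT]; last by apply/is_derive_colP => j; apply: (uv j).2.
by apply/subspace_continuousP => t tT; apply/cvg_colP => j; apply: (uv j).1.
Qed.

End columns.

Section coordinates.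
Variables (R : realType) (N n m : nat).

(** A finite index type for the scalar components, so that states become functions to which the
    existence theory above applies. *)
Definition coordinate := (('I_N * 'I_m * 'I_n) + ('I_N * 'I_n) + 'I_N + 'I_N)%type.

Definition coords (s : state R N n m) (a : coordinate) : R := match a with
  | inl (inl (inl (i, k, j))) => rho s i k j 0
  | inl (inl (inr (i, j))) => xi s i j 0
  | inl (inr i) => lam s i
  | inr i => mu s i end.

Definition of_coords (q : coordinate -> R) : state R N n m :=
  State (fun i k => \col_j q (inl (inl (inl (i, k, j)))))
    (fun i => \col_j q (inl (inl (inr (i, j)))))
    (fun i => q (inl (inr i))) (fun i => q (inr i)).

Lemma coordsK s : of_coords (coords s) = s.
Proof.
case: s => r x l u; rewrite /of_coords /=; congr State.
  by apply/funext => i; apply/funext => k; apply/colP => j; rewrite mxE.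
by apply/funext => i; apply/colP => j; rewrite mxE.
Qed.

Lemma of_coordsK q : coords (of_coords q) = q.
Proof. by apply/funext => -[[[[[i k] j]|[i j]]|i]|i] //=; rewrite mxE. Qed.

Definition cvg_state (T : Type) (G : set_system T) (S : T -> state R N n m) s :=
  coord_cvg G (coords \o S) (coords s).

Lemma cvg_stateP (T : Type) (G : set_system T) (S : T -> state R N n m) s :
  Filter G -> cvg_state G S s <->
  [/\ forall i k, (fun t => rho (S t) i k) @ G --> rho s i k,
      forall i, (fun t => xi (S t) i) @ G --> xi s i,
      forall i, (fun t => lam (S t) i) @ G --> lam s i
    & forall i, (fun t => mu (S t) i) @ G --> mu s i].
Proof.
move=> FG; split=> [Ss|[rs xs ls us] [[[[[i k] j]|[i j]]|i]|i] /=].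
- split=> i => [k|||].
  + by apply/cvg_colP => j; exact: (Ss (inl (inl (inl (i, k, j))))).
  + by apply/cvg_colP => j; exact: (Ss (inl (inl (inr (i, j))))).
  + exact: (Ss (inl (inr i))).
  + exact: (Ss (inr i)).
- by have /cvg_colP := rs i k; apply.
- by have /cvg_colP := xs i; apply.
- exact: ls.
- exact: us.
Qed.

End coordinates.

(** * Continuity of the vector field and global existence *)

Section field.
Variables (R : realType) (N n m : nat).
Variables (f g h : 'I_N -> 'cV[R]_n -> R) (E : rel 'I_N) (A : 'M[R]_N).
Variables (b c : 'I_N -> 'I_m -> R).
Hypothesis f_diff : forall i, twice_differentiable (f i).
Hypothesis g_diff : forall i, twice_differentiable (g i).
Hypothesis h_affine : forall i, affine_function (h i).

Local Notation state := (state R N n m).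
Local Notation vf := (vector_field f g h E A b c).

Lemma h_cvg (T : Type) (G : set_system T) (u : T -> 'cV[R]_n) z i : Filter G ->
  u @ G --> z -> (fun t => h i (u t)) @ G --> h i z.
Proof.
move=> FG uz; have [a [_ hB]] := affine_grad (h_affine i).
have hE y : h i y = dot a y + h i 0 by rewrite -(subr0 y) -hB !subr0 subrK.
rewrite hE; under eq_fun do rewrite hE.
by apply: cvgD; [apply: cvg_dot => //|]; exact: cvg_cst.
Qed.

Section limits.
Variables (T : Type) (G : set_system T) (S : T -> state) (s : state).
Hypothesis FG : Filter G.
Hypothesis Ss : cvg_state G S s.

Lemma output_cvg i : (fun t => output (S t) i) @ G --> output s i.
Proof.
have /(cvg_stateP _ _ FG)[rs _ _ _] := Ss.
by apply: cvg_sum => k _; exact: rs.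
Qed.

Lemma continuous_output_cvg (V : topologicalType) (F : 'cV[R]_n -> V) i :
  continuous F -> (fun t => F (output (S t) i)) @ G --> F (output s i).
Proof. by move=> cF; exact: (cvg_comp _ F (output_cvg (i := i)) (cF _)). Qed.

Lemma grad_continuous (F : 'cV[R]_n -> R) : twice_differentiable F -> continuous (grad F).
Proof. by move=> [_ dF] z; exact: differentiable_continuous. Qed.

Lemma fun_continuous (F : 'cV[R]_n -> R) : twice_differentiable F -> continuous F.
Proof. by move=> [dF _] z; exact: differentiable_continuous. Qed.

Lemma nu_cvg i : (fun t => nu f g h E A (S t) i) @ G --> nu f g h E A s i.
Proof.
have /(cvg_stateP _ _ FG)[rs xs ls us] := Ss.
have os := output_cvg.
apply: cvgB; last first.
  by apply: cvg_sum => j _; apply: cvg_scale; apply: cvgB; exact: xs.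
apply: cvgD; last first.
  by apply: cvg_sum => j _; apply: cvg_scale; apply: cvgB; exact: os.
apply: cvgB; last first.
  apply: cvgZ; first exact: us.
  have [a [aE _]] := affine_grad (h_affine i).
  by under eq_fun do rewrite aE; rewrite aE; exact: cvg_cst.
apply: cvgB.
  by apply: cvgN; apply: continuous_output_cvg; exact: grad_continuous.
apply: cvgZ; last by apply: continuous_output_cvg; exact: grad_continuous.
by rewrite expr2; under eq_fun do rewrite expr2; apply: cvgM; exact: ls.
Qed.

Lemma vector_field_cvg : cvg_state G (vf \o S) (vf s).
Proof.
have /(cvg_stateP _ _ FG)[rs xs ls us] := Ss.
apply/cvg_stateP; split=> i => [k|||] /=.
- apply: cvgD; first by apply: cvg_scale; exact: rs.
  by apply: cvg_scale; exact: nu_cvg.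
- by apply: cvg_sum => j _; apply: cvg_scale; apply: cvgB; exact: output_cvg.
- apply: cvgM; last by apply: continuous_output_cvg; exact: fun_continuous.
  by apply: cvgM; [exact: cvg_cst|exact: ls].
- by apply: h_cvg; exact: output_cvg.
Qed.

End limits.

Definition coord_field (q : coordinate N n m -> R) : coordinate N n m -> R :=
  coords (vf (of_coords q)).

Lemma coord_field_cvg (T : Type) (G : set_system T) u p : ProperFilter G ->
  coord_cvg G u p -> coord_cvg G (coord_field \o u) (coord_field p).
Proof.
move=> FG up; apply: (@vector_field_cvg T G (fun t => of_coords (u t)) (of_coords p) _).
by rewrite /cvg_state of_coordsK; under [X in coord_cvg _ X]eq_fun do rewrite /= of_coordsK.
Qed.

Lemma solution_coords T S : solution f g h E A b c T S <->
  (0 < T)%E /\ coord_solution coord_field T (fun t => coords (S t)).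
Proof.
have VE a : (fun t => coord_field (coords (S t)) a) = (fun t => coords (vf (S t)) a).
  by apply/funext => t; rewrite /coord_field coordsK.
split=> [[T0 pr px pl pu]|[T0 p]].
  split=> // a /=; rewrite VE.
  case: a => [[[[[i k] j]|[i j]]|i]|i] /=.
  - by have /primitive_on_colP := pr i k; apply.
  - by have /primitive_on_colP := px i; apply.
  - by have /primitive_onP := pl i.
  - by have /primitive_onP := pu i.
have {}p a : scalar_primitive T (fun t => coords (S t) a) (fun t => coords (vf (S t)) a).
  by have := p a; rewrite /= VE.
split=> // i => [k|||].
- by apply/primitive_on_colP => j; exact: (p (inl (inl (inl (i, k, j))))).
- by apply/primitive_on_colP => j; exact: (p (inl (inl (inr (i, j))))).
- by apply/primitive_onP; exact: (p (inl (inr i))).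
- by apply/primitive_onP; exact: (p (inr i)).
Qed.

Lemma coord_cvg_ultra (T : Type) (U : set_system T) (I : finType) (u : T -> I -> R) M :
  UltraFilter U -> (\forall t \near U, forall a, `|u t a| <= M) ->
  exists p, coord_cvg U u p.
Proof.
move=> UU uM; have UP : ProperFilter U := ultra_proper.
have lim a : exists l : R, u^~ a @ U --> l.
  by apply: (bounded_cvg_ultra (M := M)); apply: filterS uM => t; apply.
by have [p hp] := choice lim; exists p.
Qed.

(** Were the field unbounded on [D], a sequence in [D] with values exceeding every integer would
    converge along an ultrafilter, and continuity at the limit, which may lie outside [D], would
    bound these values. *)
Lemma vector_field_bounded (D : set state) (M : R) : (forall s a, D s -> `|coords s a| <=
  M) ->
  exists K, forall s a, D s -> `|coords (vf s) a| <= K.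
Proof.
move=> DM; apply: contrapT => nK.
have {nK} /choice[u uK] (k : nat) : exists s, D s /\ exists a, k%:R < `|coords (vf s) a|.
  apply: contrapT => nu; apply: nK; exists k%:R => s a Ds; rewrite leNgt; apply/negP => lt.
  by apply: nu; exists s; split=> //; exists a.
have [U [UU ooU]] := ultraFilterLemma (eventually_filter).
have [p up] : exists p, coord_cvg U (fun k => coords (u k)) p.
  apply: (coord_cvg_ultra (M := M)); apply: filterE => k a.
  by apply: DM; case: (uK k).
have /vector_field_cvg vp : cvg_state U u (of_coords p) by rewrite /cvg_state of_coordsK.
have near a : \forall k \near U, `|coords (vf (u k)) a| < `|coords (vf (of_coords p)) a| +
  1.
  have /cvgrPdist_lt/(_ _ ltr01) := vp a; apply: filterS => k /= lt.
  rewrite -[coords (vf (u k)) a](subKr (coords (vf (of_coords p)) a)).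
  by apply: le_lt_trans (ler_normB _ _) _; rewrite ltrD2l.
have {}near : \forall k \near U, forall a, `|coords (vf (u k)) a| < `|coords (vf (of_coords
  p)) a| + 1.
  exact: filter_forall.
pose B := \sum_a `|coords (vf (of_coords p)) a| + 1.
have large : \forall k \near U, B < k%:R by apply: ooU; exact: nbhs_infty_gtr.
have [k [lt_k gt_k]] := filter_ex (filterI near large).
have [_ [a ka]] := uK k; have := lt_k a.
have : `|coords (vf (of_coords p)) a| + 1 <= B.
  by rewrite lerD2r (bigD1 a)//= lerDl sumr_ge0.
lra.
Qed.

Lemma bounded_trajectory_global T S M : trajectory f g h E A b c T S ->
  (forall t a, horizon T t -> `|coords (S t) a| <= M) -> T = +oo%E.
Proof.
move=> [sol maxT] SM; case: T sol maxT SM => [T| |] sol maxT SM //; last first.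
  by case: sol; rewrite ltNge leNye.
have [T0 csol] := (solution_coords _ _).1 sol; rewrite lte_fin in T0.
have [|K FK] := @vector_field_bounded [set S t | t in horizon T%:E] M.
  by move=> _ a [t tT <-]; exact: SM.
have [|T' TT' [w wsol wS]] := solution_extension coord_field_cvg T0 csol (K := K).
  move=> t a /andP[t0 tT]; rewrite /coord_field coordsK; apply: FK.
  by exists t => //; split; rewrite ?ltW ?lte_fin.
have : T'%:E = T%:E.
  apply: (maxT _ (fun t => of_coords (w t))); last 2 first.
  - by rewrite lee_fin ltW.
  - by move=> t [_]; rewrite lte_fin => tT; rewrite wS// coordsK.
  apply/solution_coords; split; first by rewrite lte_fin (lt_trans T0).
  by have -> : (fun t => coords (of_coords (w t))) = w by apply/funext => t; rewrite
    of_coordsK.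
by move=> [TE]; rewrite TE ltxx in TT'.
Qed.

End field.

(** * The Lyapunov functions *)

Section primitive_calculus.
Variables (R : realType) (T : \bar R).
Implicit Types u v : R -> R.

Lemma scalar_primitive_cst k : scalar_primitive T (fun=> k : R) (fun=> 0).
Proof. by split=> *; [exact: cvg_cst|exact: is_derive_cst]. Qed.

Lemma scalar_primitiveD u1 v1 u2 v2 : scalar_primitive T u1 v1 ->
  scalar_primitive T u2 v2 ->
  scalar_primitive T (fun t => u1 t + u2 t) (fun t => v1 t + v2 t).
Proof.
move=> [c1 d1] [c2 d2]; split=> [t tT|t t0 tT].
  by apply: cvgD; [exact: c1|exact: c2].
by apply: is_deriveD; [exact: d1|exact: d2].
Qed.

Lemma scalar_primitiveM u1 v1 u2 v2 : scalar_primitive T u1 v1 ->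
  scalar_primitive T u2 v2 ->
  scalar_primitive T (fun t => u1 t * u2 t) (fun t => v1 t * u2 t + u1 t * v2 t).
Proof.
move=> [c1 d1] [c2 d2]; split=> [t tT|t t0 tT].
  by apply: cvgM; [exact: c1|exact: c2].
have D1 := d1 t t0 tT; have D2 := d2 t t0 tT.
apply: (is_derive_eq (is_deriveM D1 D2)).
by rewrite addrC [v1 t * _]mulrC.
Qed.

Lemma scalar_primitiveZ k u v : scalar_primitive T u v ->
  scalar_primitive T (fun t => k * u t) (fun t => k * v t).
Proof.
move=> uv; have := scalar_primitiveM (scalar_primitive_cst k) uv.
by under [X in scalar_primitive _ _ X]eq_fun do rewrite mul0r add0r.
Qed.

Lemma scalar_primitive_sum (J : finType) (u v : J -> R -> R) :
  (forall j, scalar_primitive T (u j) (v j)) ->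
  scalar_primitive T (fun t => \sum_j u j t) (fun t => \sum_j v j t).
Proof.
move=> uv; elim: (index_enum J) => [|j s IH].
  under eq_fun do rewrite big_nil; under [X in scalar_primitive _ _ X]eq_fun do rewrite
    big_nil.
  exact: scalar_primitive_cst.
under eq_fun do rewrite big_cons; under [X in scalar_primitive _ _ X]eq_fun do rewrite
  big_cons.
exact: scalar_primitiveD.
Qed.

Lemma scalar_primitive_sqr k u v : scalar_primitive T u v ->
  scalar_primitive T (fun t => (u t - k) ^+ 2) (fun t => 2 * ((u t - k) * v t)).
Proof.
move=> uv; have uk := scalar_primitiveD uv (scalar_primitive_cst (- k)).
have := scalar_primitiveM uk uk.
set a := (X in scalar_primitive _ X _ -> _); set b := (X in scalar_primitive _ _ X -> _).
have -> : a = fun t => (u t - k) ^+ 2 by apply/funext => t; rewrite expr2.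
by have -> : b = fun t => 2 * ((u t - k) * v t) by apply/funext => t; rewrite /b; ring.
Qed.

Lemma scalar_primitive_ln u v : (forall t, horizon T t -> 0 < u t) ->
  scalar_primitive T u v -> scalar_primitive T (fun t => ln (u t)) (fun t => v t / u t).
Proof.
move=> u0 [cu du]; split=> [t tT|t t0 tT].
  apply: (cvg_comp _ _ (cu t tT)); exact: continuous_ln (u0 t tT).
have ut0 : 0 < u t by apply: u0; split=> //; exact: ltW.
have D1 := is_derive1_ln ut0; have D2 := du t t0 tT.
by apply: (is_derive_eq (is_derive1_comp D1 D2)); rewrite mulrC.
Qed.

End primitive_calculus.

Section log_distance.
Variable R : realType.
Implicit Types l a : R.

(* If [l' = 2 l g] then [log_distance l a] has derivative [4 (l^2 - a^2) g]; the value
   of [ln a] at [a = 0] is irrelevant. *)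
Definition log_distance l a : R := l ^+ 2 - a ^+ 2 - 2 * a ^+ 2 * (ln l - ln a).

(** This is [ln x <= x - 1] at [x = l / a]; for [a = 0] the logarithm has coefficient 0 and [l] may
    vanish. *)
Lemma log_distance_ge l a : (0 < a -> 0 < l) -> 0 <= a ->
  (l - a) ^+ 2 <= log_distance l a.
Proof.
move=> al; rewrite le_eqVlt => /predU1P[<-|a0].
  by rewrite /log_distance expr0n /= mulr0 mul0r !subr0.
have l0 := al a0.
have : ln (1 + (l / a - 1)) <= l / a - 1.
  by apply: le_ln1Dx; rewrite ltrBDr addNr divr_gt0.
rewrite subrKC ln_div ?posrE// => lnle.
have := ler_wpM2l (sqr_ge0 a) lnle.
have -> : a ^+ 2 * (l / a - 1) = a * l - a ^+ 2.
  by field; rewrite gt_eqF.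
by rewrite /log_distance; nra.
Qed.

Lemma log_distancexx a : log_distance a a = 0.
Proof. by rewrite /log_distance !subrr mulr0 subr0. Qed.

End log_distance.

(** A solution of a linear equation cannot reach 0 in finite time, and the intermediate value
    theorem then preserves its sign. Only the decrease of [u ^+ 2] has to be controlled, so a lower
    bound of [v] on [[0, t]] is enough. *)
Lemma linear_growth_positive (R : realType) (T : \bar R) (u v : R -> R) :
  scalar_primitive T u (fun t => 2 * u t * v t) ->
  (forall t, horizon T t -> v @ within (horizon T) (nbhs t) --> v t) ->
  0 < u 0 -> forall t, horizon T t -> 0 < u t.
Proof.
move=> uv cv u0.
have nz t : horizon T t -> u t != 0.
  move=> [t0 tT]; have [->|tn0] := eqVneq t 0; first by rewrite gt_eqF.
  have {tn0}t0 : 0 < t by rewrite lt_def tn0.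
  have seg r : 0 <= r <= t -> horizon T r.
    by move=> /andP[r0 rt]; split=> //; apply: le_lt_trans tT; rewrite lee_fin.
  have cv' : {within `[0, t], continuous v}.
    apply: (@continuous_subspaceW _ _ _ (horizon T)).
      by move=> r; rewrite /= in_itv; exact: seg.
    exact/subspace_continuousP.
  have [r _ vr] := EVT_min (ltW t0) cv'.
  (* [u^2 e^(4 C t)] is nondecreasing on [0, t]. *)
  pose C := - v r.
  have ev : scalar_primitive T (fun s => expR (4 * C * s)) (fun s => 4 * C * expR (4 * C *
    s)).
    have de (s : R) : is_derive s 1 (fun s : R => expR (4 * C * s)) (4 * C * expR (4 * C *
      s)).
      have d1 : is_derive s 1 (fun s : R => 4 * C * s) (4 * C).
        by apply: is_derive_eq; rewrite /GRing.scale /= mulr1.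
      by apply: (is_derive_eq (is_derive1_comp (is_derive_expR _) d1)); rewrite mulrC.
    split=> // s _; apply: cvg_within_filter.
    have cs : {for s, continuous (fun s : R => expR (4 * C * s))}.
      by have [ds _] := de s; exact/differentiable_continuous/derivable1_diffP.
    exact: cs.
  have w := scalar_primitiveM (scalar_primitiveM uv uv) ev.
  have [x /andP[x0 xt]] := primitive_mvt w (lexx 0) t0 tT.
  rewrite mulr0 expR0 mulr1 subr0 => E.
  apply/negP => /eqP ut0; move: E; rewrite ut0 !mul0r sub0r => E.
  have vx : v r <= v x by apply: vr; rewrite in_itv /= !ltW.
  have : 0 <= ((2 * u x * v x * u x + u x * (2 * u x * v x)) * expR (4 * C * x) + u x * u x
    * (4 * C * expR (4 * C * x))) * t.
    apply: mulr_ge0; last exact: ltW.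
    have -> : (2 * u x * v x * u x + u x * (2 * u x * v x)) * expR (4 * C * x) + u x * u x
      * (4 * C * expR (4 * C * x)) = 4 * (u x) ^+ 2 * (v x - v r) * expR (4 * C * x) by
      rewrite /C; ring.
    apply: mulr_ge0; last exact: expR_ge0.
    by apply: mulr_ge0; rewrite ?subr_ge0// mulr_ge0 ?sqr_ge0.
  by rewrite -E oppr_ge0 leNgt mulr_gt0.
move=> t [t0 tT]; rewrite ltNge; apply/negP => ut.
have [] := @IVT R u 0 t 0 t0 (primitive_continuous uv (lexx _) tT).
  by rewrite ge_min ut orbT /= le_max ltW.
move=> x; rewrite in_itv /= => /andP[x0 xt] /eqP; apply/negP/nz; split=> //.
by apply: le_lt_trans tT; rewrite lee_fin.
Qed.

(** Continuous induction: at the supremum of the times up to which the bound holds, the last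
    hypothesis gives the strict bound again, and continuity carries it further to the right. *)
Lemma first_exit (R : realType) (u : R -> R) (t0 e : R) :
  (forall t, t0 < t -> {for t, continuous u}) -> u @ t0^'+ --> u t0 -> u t0 < e ->
  (forall t, t0 < t -> (forall r, t0 < r < t -> u r < e) -> u t < e) ->
  forall t, t0 <= t -> u t < e.
Proof.
move=> uc uc0 ut0 step t1; rewrite le_eqVlt => /predU1P[<-//|t01].
pose Z := [set s | t0 <= s <= t1 /\ forall r, t0 <= r <= s -> u r < e].
have Z0 : Z t0 by split=> [|r]; [rewrite lexx ltW|move=> /le_anti <-].
have Zub : ubound Z t1 by move=> s [/andP[]].
have supZ : has_sup Z by split; [exists t0|exists t1].
pose s := sup Z.
have t0s : t0 <= s by exact: (ub_le_sup supZ.2).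
have st1 : s <= t1 by apply: ge_sup => //; exists t0.
have below r : t0 <= r -> r < s -> u r < e.
  move=> r0 rs; have [x [_ xZ] rx] := sup_gt supZ.1 rs.
  by apply: xZ; rewrite r0 ltW.
have us : u s < e.
  move: t0s; rewrite le_eqVlt => /predU1P[<-//|t0s].
  by apply: step => // r /andP[r0 rs]; apply: below => //; exact: ltW.
have right : \forall x \near s^'+, u x < e.
  have cs : u @ s^'+ --> u s.
    move: t0s; rewrite le_eqVlt => /predU1P[<-//|t0s].
    by apply: cvg_at_right_filter; exact: uc.
  have es : 0 < e - u s by rewrite subr_gt0.
  have /cvgrPdist_lt/(_ _ es) := cs; apply: filterS => x.
  by rewrite ltr_norml => /andP[? ?]; lra.
move: st1; rewrite le_eqVlt => /predU1P[<-//|st1].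
have [d /= d0 dx] : exists2 d : R, 0 < d & forall x, s < x -> x < s + d -> u x < e.
  move: right => /nbhs_ballP[d d0 dP]; exists d => // x sx xd.
  by apply: dP => //; rewrite /ball /= ltr_distl; apply/andP; split; lra.
pose s' := Num.min (s + d / 2) t1.
have ss' : s < s' by rewrite lt_min st1 andbT; lra.
suff : Z s' by move/(ub_le_sup supZ.2); rewrite leNgt ss'.
split=> [|r /andP[r0 rs']]; first by rewrite (le_trans t0s (ltW ss')) /= ge_min lexx orbT.
have [rs|rs|->//] := ltgtP r s; first exact: below.
apply: dx => //; apply: le_lt_trans rs' _; rewrite gt_min; apply/orP; left; lra.
Qed.

(** * Energy balance and boundedness along solutions *)

Section convergence.
Variables (R : realType) (N n m : nat).
Variables (f g h : 'I_N -> 'cV[R]_n -> R) (E : rel 'I_N) (A : 'M[R]_N).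
Variables (b c : 'I_N -> 'I_m -> R).
Hypothesis f_convex : forall i, convex_function setT (f i).
Hypothesis g_convex : forall i, convex_function setT (g i).
Hypothesis f_diff : forall i, twice_differentiable (f i).
Hypothesis g_diff : forall i, twice_differentiable (g i).
Hypothesis h_affine : forall i, affine_function (h i).
Hypothesis A_adjacency : adjacency_matrix E A.
Hypothesis E_connected : connected_graph E.
Hypothesis b_ge0 : forall i k, 0 <= b i k.
Hypothesis b_first : forall i, exists k, b i k = 0.
Hypothesis b_last : forall i, exists k, b i k != 0.
Hypothesis c_positive : forall i k, 0 < c i k.

Local Notation state := (state R N n m).
Local Notation vf := (vector_field f g h E A b c).
Local Notation nu := (nu f g h E A).
Local Notation equil := (equilibrium f g h E A b c).
Implicit Types p q s : state.

(** The weights [(c i k)^-1] cancel the gains in front of [nu], so that the deviations of the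
    [rho s i k] enter the pairing with [nu] only through their sum, the deviation of the output. The
    divisor 4 matches the derivative of [log_distance]. *)
Definition lyap p s : R :=
  \sum_i \sum_k (c i k)^-1 / 2 * dot (rho s i k - rho p i k) (rho s i k - rho p i k)
  + \sum_i dot (xi s i - xi p i) (xi s i - xi p i) / 2
  + \sum_i (mu s i - mu p i) ^+ 2 / 2
  + \sum_i log_distance (lam s i) (lam p i) / 4.

Definition lyap_rate p s : R :=
  \sum_i \sum_k (c i k)^-1 * dot (rho s i k - rho p i k) (rho (vf s) i k)
  + \sum_i dot (xi s i - xi p i) (xi (vf s) i)
  + \sum_i (mu s i - mu p i) * mu (vf s) i
  + \sum_i (lam s i ^+ 2 - lam p i ^+ 2) * g i (output s i).

Definition dissipation p s : R :=
  \sum_i \sum_k b i k / c i k * dot (rho s i k - rho p i k) (rho s i k - rho p i k)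
  + disagreement A (fun i => output s i - output p i) / 2
  + \sum_i (bregman (f i) (output p i) (output s i) + bregman (f i) (output s i) (output p
    i))
  + \sum_i lam s i ^+ 2 * bregman (g i) (output p i) (output s i)
  + \sum_i lam p i ^+ 2 * bregman (g i) (output s i) (output p i).

Lemma equilibriumP p : equil p <->
  [/\ forall i, nu p i = 0, forall i k, b i k *: rho p i k = 0,
    forall i, lap A (output p) i = 0, forall i, lam p i * g i (output p i) = 0
    & forall i, h i (output p i) = 0].
Proof.
split=> [[pr px pl pu]|[nu0 br lx lg hx]].
  have nu0 i : nu p i = 0.
    have [k bk] := b_first i; have := pr i k; rewrite /= bk oppr0 scale0r add0r.
    by move/eqP; rewrite scaler_eq0 gt_eqF//= => /eqP.
  split=> // i => [k||].
  - have := pr i k; rewrite /= nu0 scaler0 addr0 scaleNr => /eqP.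
    by rewrite oppr_eq0 => /eqP.
  - by have := px i; rewrite /= (edge_sum A_adjacency).
  - have := pl i; rewrite /= -mulrA => /eqP.
    by rewrite mulf_eq0 pnatr_eq0 /= => /eqP.
split=> i => [k|||] /=.
- by rewrite nu0 scaler0 addr0 scaleNr br oppr0.
- by rewrite (edge_sum A_adjacency).
- by rewrite -mulrA lg mulr0.
- exact: hx.
Qed.

Lemma nuE s i : nu s i = - grad (f i) (output s i) - lam s i ^+ 2 *: grad (g i) (output s i)
  - mu s i *: grad (h i) (output s i) + lap A (output s) i - lap A (xi s) i.
Proof. by rewrite /Defs.nu !(edge_sum A_adjacency). Qed.

(** The couplings cancel: outputs with [xi] by symmetry of the Laplacian, with [mu] because [h] is
    affine, and with [lam] up to Bregman remainders and the values [g i (output p i)]. Of the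
    latter, those weighted by [lam p i ^+ 2] vanish by complementarity. *)
Lemma lyap_rateE p s : equil p ->
  lyap_rate p s = - dissipation p s + \sum_i lam s i ^+ 2 * g i (output p i).
Proof.
move=> /equilibriumP[nu0 br lx lg hx].
(* Both deviations are introduced through existentials, hence opaque until [dxE] or [dxiE] is
   used. *)
have [dx dxE] : exists dx, dx = fun i => output s i - output p i by exists (fun i => output
  s i - output p i).
have [dxi dxiE] : exists dx, dx = fun i => xi s i - xi p i by exists (fun i => xi s i - xi
  p i).
have rhoE : \sum_i \sum_k (c i k)^-1 * dot (rho s i k - rho p i k) (rho (vf s) i k) =
  - (\sum_i \sum_k b i k / c i k * dot (rho s i k - rho p i k) (rho s i k - rho p i k))
  + \sum_i dot (dx i) (nu s i).
  rewrite -sumrN -big_split; apply: eq_bigr => i _ /=.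
  have -> : dx i = \sum_k (rho s i k - rho p i k) by rewrite dxE /output sumrB.
  rewrite dot_suml -sumrN -big_split; apply: eq_bigr => k _ /=.
  have -> : - b i k *: rho s i k = - b i k *: (rho s i k - rho p i k).
    by rewrite scalerBr !scaleNr br oppr0 subr0.
  move: (rho s i k - rho p i k) => D.
  by rewrite dotDr !dotZr; field; rewrite gt_eqF.
have xiE : \sum_i dot (xi s i - xi p i) (xi (vf s) i) = \sum_i dot (dx i) (lap A dxi i).
  rewrite -(lap_sym A_adjacency); apply: eq_bigr => i _; rewrite /= (edge_sum A_adjacency).
  by rewrite dxE dxiE lapB lx subr0 dotC.
have nudiff i : dot (dx i) (nu s i) =
    - (bregman (f i) (output p i) (output s i) + bregman (f i) (output s i) (output p i))
    - lam s i ^+ 2 * bregman (g i) (output p i) (output s i)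
    - lam p i ^+ 2 * bregman (g i) (output s i) (output p i)
    + lam s i ^+ 2 * g i (output p i)
    - (lam s i ^+ 2 - lam p i ^+ 2) * g i (output s i)
    - (mu s i - mu p i) * h i (output s i)
    + dot (dx i) (lap A dx i) - dot (dx i) (lap A dxi i).
  have -> : nu s i = nu s i - nu p i by rewrite nu0 subr0.
  have [a [aE hB]] := affine_grad (h_affine i).
  have hs : h i (output s i) = dot a (dx i) by rewrite -[LHS]subr0 -(hx i) hB dxE.
  have lapdx : lap A dx i = lap A (output s) i - lap A (output p) i by rewrite dxE lapB.
  have lapdxi : lap A dxi i = lap A (xi s) i - lap A (xi p) i by rewrite dxiE lapB.
  rewrite hs !nuE !aE lapdx lapdxi -(bregman_sym (f i)).
  have lg2 : lam p i ^+ 2 * g i (output p i) = 0 by rewrite expr2 -mulrA lg mulr0.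
  have b1 : dot (grad (g i) (output s i)) (dx i) = bregman (g i) (output p i) (output s i)
    - g i (output p i) + g i (output s i).
    by rewrite /bregman -[output p i - output s i]opprB dotNr dxE; ring.
  have b2 : dot (grad (g i) (output p i)) (dx i) = g i (output s i) - g i (output p i) -
    bregman (g i) (output s i) (output p i).
    by rewrite /bregman dxE; ring.
  rewrite [dot (grad _ _ - _) _]dotBl -[output s i - output p i]/((fun i => output s i -
    output p i) i) -dxE.
  rewrite !(dotC (dx i)) !(dotDl, dotBl, dotNl, dotZl) b1 b2.
  by rewrite -[RHS]subr0 -lg2; ring.
rewrite /lyap_rate rhoE xiE; under [X in _ + X + _ + _ + _]eq_bigr do rewrite nudiff.
rewrite /dissipation -dxE.
have -> : disagreement A dx / 2 = - \sum_i dot (dx i) (lap A dx i).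
  by rewrite (lap_energy A_adjacency) opprK.
rewrite !(big_split, sumrB, sumrN) /=; ring.
Qed.

Lemma dissipation_terms_ge0 p s :
  [/\ forall i k, 0 <= b i k / c i k * dot (rho s i k - rho p i k) (rho s i k - rho p i k),
  0 <= disagreement A (fun i => output s i - output p i) / 2,
  forall i, 0 <= bregman (f i) (output p i) (output s i) + bregman (f i) (output s i)
    (output p i),
  forall i, 0 <= lam s i ^+ 2 * bregman (g i) (output p i) (output s i)
  & forall i, 0 <= lam p i ^+ 2 * bregman (g i) (output s i) (output p i)].
Proof.
have df i z : differentiable (f i) z by case: (f_diff i).
have dg i z : differentiable (g i) z by case: (g_diff i).
split=> [i k||i|i|i].
- by rewrite mulr_ge0 ?dot_ge0// divr_ge0// ltW.
- by rewrite divr_ge0// (disagreement_ge0 A_adjacency).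
- by rewrite addr_ge0 ?bregman_ge0.
- by rewrite mulr_ge0 ?sqr_ge0 ?bregman_ge0.
- by rewrite mulr_ge0 ?sqr_ge0 ?bregman_ge0.
Qed.

Lemma dissipation_ge0 p s : 0 <= dissipation p s.
Proof.
have [t1 t2 t3 t4 t5] := dissipation_terms_ge0 p s.
by rewrite !addr_ge0// sumr_ge0// => i _; rewrite sumr_ge0.
Qed.

Lemma dissipation_eq0 p s : dissipation p s = 0 ->
  [/\ forall i k, b i k *: (rho s i k - rho p i k) = 0,
  disagreement A (fun i => output s i - output p i) = 0,
  forall i, grad (f i) (output s i) = grad (f i) (output p i),
  forall i, lam s i ^+ 2 *: grad (g i) (output p i) = lam s i ^+ 2 *: grad (g i) (output s
    i)
  & forall i, lam p i ^+ 2 * bregman (g i) (output s i) (output p i) = 0].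
Proof.
have df i z : differentiable (f i) z by case: (f_diff i).
have dg i z : differentiable (g i) z by case: (g_diff i).
have [t1 t2 t3 t4 t5] := dissipation_terms_ge0 p s.
have s1 i : 0 <= \sum_k b i k / c i k * dot (rho s i k - rho p i k) (rho s i k - rho p i k).
  by rewrite sumr_ge0.
rewrite /dissipation => /eqP.
rewrite paddr_eq0 ?addr_ge0// ?sumr_ge0// => /andP[+ /eqP z5].
rewrite paddr_eq0 ?addr_ge0// ?sumr_ge0// => /andP[+ /eqP z4].
rewrite paddr_eq0 ?addr_ge0// ?sumr_ge0// => /andP[+ /eqP z3].
rewrite paddr_eq0 ?addr_ge0// ?sumr_ge0// => /andP[/eqP z1 /eqP z2].
have zero (J : finType) (u : J -> R) : (forall j, 0 <= u j) -> \sum_j u j = 0 -> forall j,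
  u j = 0.
  move=> u0 /eqP; rewrite psumr_eq0// => /allP H j.
  by apply/eqP; exact: H (mem_index_enum j).
split=> [i k||i|i|i].
- have /eqP := zero _ _ (t1 i) (zero _ _ s1 z1 i) k.
  rewrite mulf_eq0 mulf_eq0 invr_eq0 (gt_eqF (c_positive i k)) orbF =>
    /orP[/eqP->|/eqP/dot_eq0->].
    by rewrite scale0r.
  by rewrite scaler0.
- by apply/eqP; move/eqP: z2; rewrite mulf_eq0 invr_eq0 pnatr_eq0 orbF.
- have := zero _ _ t3 z3 i; have := bregman_ge0 (output p i) (f_convex i) (df i (output s
  i)).
  have := bregman_ge0 (output s i) (f_convex i) (df i (output p i)) => h1 h2 h3.
  by apply: bregman_eq0 => //; lra.
- have /eqP := zero _ _ t4 z4 i; rewrite mulf_eq0 => /orP[/eqP->|/eqP].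
    by rewrite !scale0r.
  by move/bregman_eq0 => ->.
- exact: zero _ _ t5 z5 i.
Qed.

Lemma lyap_terms_ge0 p s : (forall i, 0 < lam p i -> 0 < lam s i) -> (forall i, 0 <= lam p
  i) ->
  [/\ forall i k, 0 <= (c i k)^-1 / 2 * dot (rho s i k - rho p i k) (rho s i k - rho p i k),
  forall i, 0 <= dot (xi s i - xi p i) (xi s i - xi p i) / 2,
  forall i, 0 <= (mu s i - mu p i) ^+ 2 / 2 &
  forall i, 0 <= log_distance (lam s i) (lam p i) / 4].
Proof.
move=> sp p0; split=> [i k|i|i|i].
- by rewrite mulr_ge0 ?dot_ge0// divr_ge0 ?invr_ge0 ?ltW.
- by rewrite divr_ge0 ?dot_ge0.
- by rewrite divr_ge0 ?sqr_ge0.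
- by rewrite divr_ge0// (le_trans (sqr_ge0 _) (log_distance_ge (sp i) (p0 i))).
Qed.

(** One constant serves all [p] and [s]: [4] undoes the divisors of the [xi], [mu] and [lam] parts,
    and [2 * c i k] the weights of the [rho] part. The first premise keeps [ln] at positive
    arguments wherever its coefficient is nonzero. *)
Lemma lyap_coercive : exists2 B : R, 0 < B & forall p s,
  (forall i, 0 < lam p i -> 0 < lam s i) -> (forall i, 0 <= lam p i) ->
  forall a, (coords s a - coords p a) ^+ 2 <= B * lyap p s.
Proof.
exists (4 + \sum_i \sum_k 2 * c i k).
  by rewrite ltr_pwDl// !sumr_ge0// => i _; rewrite sumr_ge0// => k _; rewrite mulr_ge0//
    ltW.
move=> p s sp p0 a; have [t1 t2 t3 t4] := lyap_terms_ge0 sp p0.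
have single (J : finType) (u : J -> R) j : (forall j, 0 <= u j) -> u j <= \sum_j u j.
  by move=> u0; rewrite (bigD1 j)//= lerDl sumr_ge0.
have s1 i : 0 <= \sum_k (c i k)^-1 / 2 * dot (rho s i k - rho p i k) (rho s i k - rho p i
  k).
  exact: sumr_ge0.
have pos (J : finType) (u : J -> R) : (forall j, 0 <= u j) -> 0 <= \sum_j u j.
  by move=> u0; exact: sumr_ge0.
have := pos _ _ s1; have := pos _ _ t2; have := pos _ _ t3; have := pos _ _ t4.
have c0 i : 0 <= \sum_k 2 * c i k by apply: sumr_ge0 => k _; rewrite mulr_ge0// ltW.
have C0 : 0 <= \sum_i \sum_k 2 * c i k by exact: sumr_ge0.
rewrite /lyap; move: C0.
set B := \sum_i \sum_k 2 * c i k.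
case: a => [[[[[i k] j]|[i j]]|i]|i] /=.
- have e1 := single _ _ i s1; have e2 := single _ _ k (t1 i).
  have := dot_coord (rho s i k - rho p i k) j; rewrite !mxE.
  have cB : 2 * c i k <= B.
    by apply: le_trans (single _ _ k _) (single _ _ i c0) => l; rewrite mulr_ge0// ltW.
  move: e1; set X := \sum_i \sum_k _; set Y := \sum_i _ / 2; set Z := \sum_i _ / 2; set V
    := \sum_i _ / 4.
  move=> e1 dle B0 V0 Z0 Y0 X0.
  have dX : (c i k)^-1 / 2 * dot (rho s i k - rho p i k) (rho s i k - rho p i k) <= X by
    apply: le_trans e1.
  have {}dX : dot (rho s i k - rho p i k) (rho s i k - rho p i k) <= 2 * c i k * X.
    rewrite -(ler_pM2l (x := (c i k)^-1 / 2)) ?divr_gt0 ?invr_gt0//.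
    apply: le_trans dX _; rewrite le_eqVlt; apply/orP; left; apply/eqP.
    by field; rewrite gt_eqF.
  apply: le_trans dle _; apply: le_trans dX _.
  apply: ler_pM => //; [by rewrite mulr_ge0// ltW|lra|lra].
- have := single _ _ i t2.
  have := dot_coord (xi s i - xi p i) j; rewrite !mxE.
  set X := \sum_i \sum_k _; set Y := \sum_i _ / 2; set Z := \sum_i _ / 2; set V := \sum_i _
    / 4.
  by move=> ? ? ? ? ? ? ?; nra.
- have := single _ _ i t4; have := log_distance_ge (sp i) (p0 i).
  set X := \sum_i \sum_k _; set Y := \sum_i _ / 2; set Z := \sum_i _ / 2; set V := \sum_i _
    / 4.
  by move=> ? ? ? ? ? ? ?; nra.
- have := single _ _ i t3.
  set X := \sum_i \sum_k _; set Y := \sum_i _ / 2; set Z := \sum_i _ / 2; set V := \sum_i _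
    / 4.
  by move=> ? ? ? ? ? ?; nra.
Qed.

Section solution.
Variables (T : \bar R) (S : R -> state).
Hypothesis S_solution : solution f g h E A b c T S.
Hypothesis lam_init : forall i, 0 < lam (S 0) i.

Lemma coords_primitive a :
  scalar_primitive T (fun t => coords (S t) a) (fun t => coords (vf (S t)) a).
Proof.
have [_ /(_ a)] := (solution_coords f g h E A b c T S).1 S_solution.
rewrite /coord_field /=.
by have -> : (fun t => coords (vf (of_coords (coords (S t)))) a) = (fun t => coords (vf (S
  t)) a)
  by apply/funext => t; rewrite coordsK.
Qed.

Lemma solution_cvg t : horizon T t -> cvg_state (within (horizon T) (nbhs t)) S (S t).
Proof. by move=> tT a; exact: (coords_primitive a).1. Qed.

Lemma lam_positive t i : horizon T t -> 0 < lam (S t) i.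
Proof.
move: t; apply: (linear_growth_positive (v := fun t => g i (output (S t) i))) => //.
  exact: (coords_primitive (inl (inr i))).
move=> t tT.
apply: (continuous_output_cvg _ (solution_cvg tT)).
exact: fun_continuous.
Qed.

Lemma lyap_primitive p :
  scalar_primitive T (fun t => lyap p (S t)) (fun t => lyap_rate p (S t)).
Proof.
have sqdot (u v : R -> 'cV[R]_n) (q : 'cV[R]_n) :
    (forall j, scalar_primitive T (fun t => u t j 0) (fun t => v t j 0)) ->
    scalar_primitive T (fun t => dot (u t - q) (u t - q)) (fun t => 2 * dot (u t - q) (v
      t)).
  move=> uv; have := scalar_primitive_sum (fun j => scalar_primitive_sqr (q j 0) (uv j)).
  congr scalar_primitive; apply/funext => t; rewrite /dot.
    by apply: eq_bigr => j _; rewrite !mxE expr2.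
  by rewrite mulr_sumr; apply: eq_bigr => j _; rewrite !mxE.
rewrite /lyap /lyap_rate.
apply: scalar_primitiveD; first apply: scalar_primitiveD; first apply: scalar_primitiveD.
- apply: scalar_primitive_sum => i; apply: scalar_primitive_sum => k.
  have := scalar_primitiveZ ((c i k)^-1 / 2) (sqdot (fun t => rho (S t) i k) (fun t => rho
    (vf (S t)) i k) (rho p i k) (fun j => coords_primitive (inl (inl (inl (i, k, j)))))).
  by congr scalar_primitive; apply/funext => t; rewrite mulrA divfK.
- apply: scalar_primitive_sum => i.
  have := scalar_primitiveZ (2^-1) (sqdot (fun t => xi (S t) i) (fun t => xi (vf (S t)) i)
    (xi p i) (fun j => coords_primitive (inl (inl (inr (i, j)))))).
  congr scalar_primitive; apply/funext => t; first by rewrite mulrC.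
  by rewrite mulrA mulVf// mul1r.
- apply: scalar_primitive_sum => i.
  have := scalar_primitiveZ (2^-1) (scalar_primitive_sqr (mu p i) (coords_primitive (inr
    i))).
  congr scalar_primitive; apply/funext => t; first by rewrite mulrC.
  by rewrite mulrA mulVf// mul1r.
- apply: scalar_primitive_sum => i.
  have lp := coords_primitive (inl (inr i)); rewrite /= in lp.
  have lnp := scalar_primitive_ln (fun t tT => lam_positive i tT) lp.
  have lsq := scalar_primitive_sqr 0 lp.
  pose a := lam p i.
  have D := scalar_primitiveD (scalar_primitiveZ (4^-1) lsq) (scalar_primitiveD
     (scalar_primitiveZ (- (2 * a ^+ 2 / 4)) lnp) (scalar_primitive_cst T (- a ^+ 2 / 4 +
       (2 * a ^+ 2 / 4) * ln a))).
  (* The two expressions of the derivative are compared on the horizon only, where [lam] is positive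
     and can be cancelled. *)
  have eqp (u u' v v' : R -> R) : scalar_primitive T u v -> (forall t, horizon T t -> u' t
    = u t) ->
     (forall t, horizon T t -> v' t = v t) -> u = u' -> scalar_primitive T u' v'.
    move=> [cu du] uu vv uE; rewrite -uE; split=> // t t0 tT.
    by rewrite vv; [exact: du|split=> //; exact: ltW].
  apply: (eqp _ _ _ _ D) => [t _|t tT|].
  + by rewrite /log_distance subr0 -/a; lra.
  + rewrite subr0 -/a; field.
    by rewrite gt_eqF ?lam_positive.
  + by apply/funext => t; rewrite /log_distance subr0 -/a; lra.
Qed.

Lemma lyap_nonincreasing p (r t : R) : equil p -> (forall i, g i (output p i) <= 0) ->
  0 <= r -> r <= t -> (t%:E < T)%E -> lyap p (S t) <= lyap p (S r).
Proof.
move=> pE pg r0 rt tT; apply: (primitive_nonincreasing (lyap_primitive p)) => // x _.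
rewrite lyap_rateE// addrC subr_le0; apply: (@le_trans _ _ 0).
  by apply: sumr_le0 => i _; rewrite mulr_ge0_le0 ?sqr_ge0.
by apply: dissipation_ge0.
Qed.

Lemma solution_bounded p : equil p -> (forall i, g i (output p i) <= 0) ->
  (forall i, 0 <= lam p i) ->
  exists M : R, forall t a, horizon T t -> `|coords (S t) a| <= M.
Proof.
move=> pE pg p0; have [B B0 coer] := lyap_coercive.
exists (\sum_a `|coords p a| + (B * lyap p (S 0) + 1)) => t a tT.
rewrite -[coords (S t) a](subrK (coords p a)) addrC.
apply: le_trans (ler_normD _ _) _; apply: lerD.
  by rewrite (bigD1 a)//= lerDl sumr_ge0.
have := coer p (S t) (fun i _ => lam_positive i tT) p0 a.
have : B * lyap p (S t) <= B * lyap p (S 0).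
  rewrite ler_pM2l//; apply: lyap_nonincreasing => //; first exact: tT.1.
  exact: tT.2.
move: (_ - _) => d ? ?; have : `|d| <= d ^+ 2 + 1 by rewrite -real_normK ?num_real//; have
  := normr_ge0 d; nra.
lra.
Qed.

End solution.

(** ** Limit points *)

Variable S : R -> state.
Hypothesis S_solution : solution f g h E A b c +oo%E S.
Hypothesis lam_init : forall i, 0 < lam (S 0) i.
Variable M : R.
Hypothesis S_bounded : forall t a, 0 <= t -> `|coords (S t) a| <= M.

Let horizonT (t : R) : 0 <= t -> horizon +oo%E t.
Proof. by move=> t0; split=> //; rewrite ltry. Qed.

Let lam_pos t i : 0 <= t -> 0 < lam (S t) i.
Proof. by move=> /horizonT tT; apply: (lam_positive S_solution lam_init i tT). Qed.

Let prim a := coords_primitive S_solution a.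

Lemma solution_lipschitz : exists2 K : R, 0 < K &
  forall a (s t : R), 0 <= s -> 0 <= t -> `|coords (S s) a - coords (S t) a| <= K * `|s -
    t|.
Proof.
have [|K FK] := @vector_field_bounded _ _ _ _ f g h E A b c f_diff g_diff h_affine
    [set S t | t in [set t : R | 0 <= t]] M.
  by move=> _ a [t t0 <-]; exact: S_bounded.
exists (`|K| + 1) => [|a s t s0 t0]; first by rewrite ltr_wpDl.
apply: (primitive_lipschitz (prim a)); [|exact: horizonT|exact: horizonT].
move=> r r0 _; apply: (@le_trans _ _ K); first by apply: FK; exists r => //; exact: ltW.
by apply: le_trans (ler_norm K) _; rewrite lerDl.
Qed.

Lemma limit_point_exists (U : set_system R) : UltraFilter U -> +oo `<=` U ->
  exists q, cvg_state U S q.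
Proof.
move=> UU ooU; have [|p up] := coord_cvg_ultra (u := fun t => coords (S t)) (M := M) UU.
  apply: ooU; near=> t => a; apply: S_bounded; near: t; exact: nbhs_pinfty_ge.
by exists (of_coords p); rewrite /cvg_state of_coordsK.
Unshelve. all: by end_near. Qed.

(** Continuity through filters, since the record [state] carries no topology. *)
Definition cvg_continuous_at (V : topologicalType) (Psi : state -> V) q :=
  forall (T : Type) (G : set_system T) (u : T -> state), ProperFilter G ->
  cvg_state G u q -> (fun t => Psi (u t)) @ G --> Psi q.

Lemma cvg_continuous_eps (Psi : state -> R) q e : cvg_continuous_at Psi q -> 0 < e ->
  exists2 d : R, 0 < d &
    forall s, (forall a, `|coords s a - coords q a| < d) -> `|Psi s - Psi q| < e.
Proof.
move=> Pq e0; have PF := coord_nbhs_filter (coords q).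
have cq : cvg_state (coord_nbhs (coords q)) (fun r => of_coords r) q.
  move=> a; apply/cvgrPdist_lt => d d0; exists d => // r /= /(_ a).
  by rewrite of_coordsK distrC.
have /cvgrPdist_lt Pc := Pq _ _ _ PF cq.
have [d d0 dP] := Pc _ e0.
exists d => // s sd; have := dP (coords s) sd; rewrite /= coordsK.
by rewrite distrC.
Qed.

Section ultra.
Variable U : set_system R.
Hypothesis UU : UltraFilter U.
Hypothesis ooU : +oo `<=` U.
Let UP : ProperFilter U := ultra_proper.
Variable q : state.
Hypothesis Sq : cvg_state U S q.

(* If [Psi q] were nonzero, [W] would keep moving by a fixed amount at arbitrarily late
   times, because [S] stays near [q] for a fixed duration. *)
Lemma barbalat (W : R -> R) (Psi : state -> R) (l : R) :
  scalar_primitive +oo%E W (fun t => Psi (S t)) -> W @ +oo --> l ->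
  cvg_continuous_at Psi q -> Psi q = 0.
Proof.
move=> Wp Wl Pq; apply/eqP; apply: contrapT => /negP Pq0.
pose e := `|Psi q| / 2; have e0 : 0 < e by rewrite divr_gt0 ?normr_gt0.
have [d d0 dP] := cvg_continuous_eps Pq e0.
have [K K0 SK] := solution_lipschitz.
(* In time [tau] a coordinate moves by at most [d / 2], so [Psi] stays above [e] in absolute value
   and [W] changes by more than [e * tau]. *)
pose tau := d / 2 / K; have tau0 : 0 < tau by rewrite !divr_gt0.
have et : 0 < e * tau / 2 by apply: divr_gt0 => //; exact: mulr_gt0.
have d20 : 0 < d / 2 by rewrite divr_gt0.
have WU : \forall t \near U, 0 <= t /\ (forall r, t <= r -> `|l - W r| < e * tau / 2).
  apply: ooU; have /cvgrPdist_lt/(_ _ et)[x [xr xW]] := Wl.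
  near=> t; split; first by near: t; exact: nbhs_pinfty_ge.
  move=> r tr; apply: xW; apply: lt_le_trans tr; near: t; exact: nbhs_pinfty_gt.
have SU : \forall t \near U, forall a, `|coords q a - coords (S t) a| < d / 2.
  by apply: filter_forall => a; have /cvgrPdist_lt := @Sq a; apply.
have [t [[t0 tW] tS]] := filter_ex (filterI WU SU).
have [|r /andP[tr rt] WE] := primitive_mvt Wp t0 (_ : t < t + tau) (ltry _).
  by rewrite ltrDl.
have Pr : `|Psi (S r) - Psi q| < e.
  apply: dP => a.
  have -> : coords (S r) a - coords q a =
    (coords (S r) a - coords (S t) a) + (coords (S t) a - coords q a) by ring.
  apply: le_lt_trans (ler_normD _ _) _.
  have := tS a; rewrite distrC => ?.
  have := SK a r t (le_trans t0 (ltW tr)) t0.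
  have -> : `|r - t| = r - t by rewrite gtr0_norm ?subr_gt0.
  have : K * (r - t) <= d / 2.
    by rewrite mulrC -ler_pdivlMr//; move: rt; rewrite /tau; lra.
  lra.
have : e < `|Psi (S r)|.
  have := ler_normB (Psi (S r)) (Psi (S r) - Psi q); rewrite subKr.
  have : `|Psi q| = 2 * e by rewrite /e; lra.
  lra.
rewrite -(ltr_pM2r tau0) => lt.
have : `|W (t + tau) - W t| < e * tau.
  have := tW t (lexx _); have := tW (t + tau) _; rewrite lerDl => /(_ (ltW tau0)).
  by rewrite !ltr_norml => /andP[? ?] /andP[? ?]; apply/andP; split; lra.
rewrite WE addrAC subrr add0r normrM (gtr0_norm tau0); lra.
Unshelve. all: by end_near. Qed.

Lemma coords_field_continuous_at a (s : state) : cvg_continuous_at (fun s => coords (vf s)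
  a) s.
Proof.
by move=> T G u PG us; exact: (vector_field_cvg f_diff g_diff h_affine _ us).
Qed.

Lemma lyap_rate_continuous_at p s : cvg_continuous_at (lyap_rate p) s.
Proof.
move=> T G u PG us; have /cvg_stateP[rs xs ls ms] := us.
have vus : cvg_state G (vf \o u) (vf s) by exact: (vector_field_cvg f_diff g_diff h_affine
  _ us).
have /cvg_stateP[vrs vxs vls vms] := vus.
apply: cvgD; first apply: cvgD; first apply: cvgD.
- apply: (@cvg_sum R R^o) => i _; apply: (@cvg_sum R R^o) => k _.
  apply: cvgM; first exact: cvg_cst.
  apply: cvg_dot; last exact: vrs.
  by apply: cvgB; [exact: rs|exact: cvg_cst].
- apply: (@cvg_sum R R^o) => i _; apply: cvg_dot; last exact: vxs.
  by apply: cvgB; [exact: xs|exact: cvg_cst].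
- apply: (@cvg_sum R R^o) => i _; apply: cvgM; last exact: vms.
  by apply: cvgB; [exact: ms|exact: cvg_cst].
- apply: (@cvg_sum R R^o) => i _; apply: cvgM; last first.
    exact: (continuous_output_cvg _ us (fun_continuous (g_diff i))).
  apply: cvgB; last exact: cvg_cst.
  by rewrite expr2; under eq_fun do rewrite expr2; apply: cvgM; exact: ls.
Qed.

Lemma lam_limit_ge0 i : 0 <= lam q i.
Proof.
have lq := @Sq (inl (inr i)).
rewrite -[lam q i](cvg_lim _ lq)//; apply: limr_ge; first exact: cvgP lq.
by apply: ooU; near=> t; apply/ltW/lam_pos; near: t; exact: nbhs_pinfty_ge.
Unshelve. all: by end_near. Qed.

End ultra.

(** Boundedness gives a limit along one ultrafilter, and monotonicity makes it the limit at
    infinity. *)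
Lemma lyap_limit p : equil p -> (forall i, g i (output p i) <= 0) ->
  (forall i, 0 <= lam p i) -> exists l : R, (fun t => lyap p (S t)) @ +oo --> l.
Proof.
move=> pE pg p0.
have [U [UU ooU]] := ultraFilterLemma (@proper_pinfty_nbhs R).
have L0 t : 0 <= t -> 0 <= lyap p (S t).
  move=> t0; have [|t1 t2 t3 t4] := @lyap_terms_ge0 p (S t) _ p0.
    by move=> i _; exact: lam_pos.
  by rewrite !addr_ge0// sumr_ge0// => i _; rewrite sumr_ge0.
have decr (s t : R) : 0 <= s -> s <= t -> lyap p (S t) <= lyap p (S s).
  by move=> s0 st; apply: (lyap_nonincreasing S_solution); rewrite ?ltry.
have near0 : \forall t \near U, 0 <= t by apply: ooU; exact: nbhs_pinfty_ge.
have [|l Ul] := @bounded_cvg_ultra _ _ U (fun t => lyap p (S t)) (lyap p (S 0)).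
  by apply: filterS near0 => t t0; rewrite ger0_norm ?L0// decr.
have lle t : 0 <= t -> l <= lyap p (S t).
  move=> t0; rewrite -(cvg_lim _ Ul)//; apply: limr_le; first exact: cvgP Ul.
  apply: ooU; near=> r; apply: decr => //; near: r; apply: nbhs_pinfty_ge; exact: num_real.
exists l; apply/cvgrPdist_lt => e e0.
have /cvgrPdist_lt/(_ _ e0) Ue := Ul.
have [t [t0 te]] := filter_ex (filterI near0 Ue).
near=> r; have tr : t <= r by near: r; apply: nbhs_pinfty_ge; exact: num_real.
have := decr t r t0 tr; have := lle r (le_trans t0 tr); have := lle t t0.
move: te; rewrite !ltr_norml => /andP[? ?] ? ? ?; apply/andP; split; lra.
Unshelve. all: by end_near. Qed.

(** * Limit points are equilibria *)

Variable p : state.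
Hypothesis p_equil : equil p.
Hypothesis p_feasible : forall i, g i (output p i) <= 0.
Hypothesis p_lam : forall i, 0 <= lam p i.

Section one_limit.
Variable U : set_system R.
Hypothesis UU : UltraFilter U.
Hypothesis ooU : +oo `<=` U.
Let UP : ProperFilter U := ultra_proper.
Variable q : state.
Hypothesis Sq : cvg_state U S q.

(** As [lyap p] converges along the trajectory, [lyap_rate p q] vanishes; it is a sum of nonpositive
    terms, so each of them is 0. *)
Lemma limit_dissipation : dissipation p q = 0 /\
  forall i, lam q i ^+ 2 * g i (output p i) = 0.
Proof.
have [l Ll] := lyap_limit p_equil p_feasible p_lam.
have := barbalat UU ooU Sq
  (lyap_primitive S_solution lam_init p) Ll
  (lyap_rate_continuous_at (s := q)).
rewrite (lyap_rateE _ p_equil).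
have d0 := dissipation_ge0 p q.
have s0 i : lam q i ^+ 2 * g i (output p i) <= 0 by rewrite mulr_ge0_le0 ?sqr_ge0.
have S0 : \sum_i lam q i ^+ 2 * g i (output p i) <= 0 by apply: sumr_le0 => i _.
move=> eq0; split; first lra.
have : \sum_i - (lam q i ^+ 2 * g i (output p i)) == 0.
  by rewrite sumrN; apply/eqP; lra.
rewrite psumr_eq0 => [/allP H i|i _]; last by rewrite oppr_ge0.
by apply/eqP; rewrite -oppr_eq0; exact: H (mem_index_enum i).
Qed.

Let facts := dissipation_eq0
  limit_dissipation.1.

Lemma limit_rho i k : b i k *: rho q i k = 0.
Proof.
have [br _ _ _ _] := facts.
have /equilibriumP[_ bp _ _ _] := p_equil.
by have := br i k; rewrite scalerBr bp subr0.
Qed.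

Lemma limit_lap i : lap A (output q) i = 0.
Proof.
have [_ dis _ _ _] := facts.
have /equilibriumP[_ _ lp _ _] := p_equil.
have := lap_cst A (disagreement_eq0 A_adjacency E_connected dis) i.
by rewrite lapB lp subr0.
Qed.

End one_limit.

Lemma rho_cvg0 i k j : b i k != 0 ->
  (fun t => coords (S t) (inl (inl (inl (i, k, j))))) @ +oo --> (0 : R).
Proof.
move=> bik; apply: cvg_ultra => U UU ooU.
have [q Sq] := limit_point_exists UU ooU.
have /eqP := limit_rho UU ooU Sq i k; rewrite scaler_eq0 (negbTE bik) /= => /eqP r0.
by have := @Sq (inl (inl (inl (i, k, j)))); rewrite /= r0 mxE.
Qed.

(** A component of [rho] with nonzero decay rate tends to 0, so Barbalat's argument applies to it;
    its rate at [q] reduces to a positive multiple of [nu q i]. *)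
Lemma limit_nu (U : set_system R) q : UltraFilter U -> +oo `<=` U -> cvg_state U S q ->
  forall i, nu q i = 0.
Proof.
move=> UU ooU Sq i; have [k bik] := b_last i; apply/colP => j; rewrite [RHS]mxE.
have cc : cvg_continuous_at (fun s => coords (vf s) (inl (inl (inl (i, k, j))))) q.
  exact: (coords_field_continuous_at).
have := barbalat UU ooU Sq
  (prim (inl (inl (inl (i, k, j))))) (rho_cvg0 j bik) cc.
rewrite /= scaleNr (limit_rho UU ooU Sq) oppr0 add0r mxE => /eqP.
by rewrite mulf_eq0 gt_eqF//= => /eqP.
Qed.

Lemma rho_rate_cvg0 i k j :
  (fun t => coords (vf (S t)) (inl (inl (inl (i, k, j))))) @ +oo --> (0 : R).
Proof.
apply: cvg_ultra => U UU ooU; have UP : ProperFilter U := ultra_proper.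
have [q Sq] := limit_point_exists UU ooU.
have cc : cvg_continuous_at (fun s => coords (vf s) (inl (inl (inl (i, k, j))))) q.
  exact: (coords_field_continuous_at).
suff <- : coords (vf q) (inl (inl (inl (i, k, j)))) = 0 by exact: (cc _ _ _ _ Sq).
by rewrite /= scaleNr (limit_rho UU ooU Sq) (limit_nu UU ooU Sq) oppr0 scaler0 addr0 mxE.
Qed.

Section one_limit_slow.
Variable U : set_system R.
Hypothesis UU : UltraFilter U.
Hypothesis ooU : +oo `<=` U.
Let UP : ProperFilter U := ultra_proper.
Variable q : state.
Hypothesis Sq : cvg_state U S q.

(** Output velocities tend to 0, so on late windows of any prescribed length the outputs hardly
    move, even though they are not yet known to converge. *)
Lemma slow_output (F : 'cV[R]_n -> R) i (tau e : R) :
  {for output q i, continuous F} -> 0 < tau -> 0 < e ->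
  \forall t \near U, tau <= t /\ forall s : R, `|s - t| <= tau ->
    `|F (output (S s) i) - F (output q i)| < e.
Proof.
move=> cF tau0 e0; have /cvgrPdist_lt/(_ _ e0)/nbhs_ballP[d /= d0 Fd] := cF.
have d20 : 0 < d / 2 by rewrite divr_gt0.
(* Velocities below [e1] displace a coordinate by at most [d / 4] within [tau]; the distance to
   [output q i] at the centre of the window takes less than [d / 2]. *)
pose e1 := d / 2 / (2 * tau); have e10 : 0 < e1 by rewrite !divr_gt0// mulr_gt0.
have oprim j : scalar_primitive +oo%E (fun t => output (S t) i j 0)
    (fun t => \sum_k coords (vf (S t)) (inl (inl (inl (i, k, j))))).
  have := scalar_primitive_sum (fun k => prim (inl (inl (inl (i, k, j))))).
  by congr scalar_primitive; apply/funext => t; rewrite /output summxE.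
have slow : \forall x \near +oo, forall j, `|\sum_k coords (vf (S x)) (inl (inl (inl (i, k,
  j))))| < e1.
  apply: filter_forall => j.
  have : (fun t => \sum_k coords (vf (S t)) (inl (inl (inl (i, k, j))))) @ +oo --> \sum_(k
    < m) (0 : R).
    by apply: (@cvg_sum R R^o) => k _; exact: rho_rate_cvg0.
  rewrite big1// => /cvgrPdist_lt/(_ _ e10); apply: filterS => x.
  by rewrite sub0r normrN.
have [x [_ xslow]] := slow.
have near_q : \forall t \near U, forall j, `|output q i j 0 - output (S t) i j 0| < d / 2.
  apply: filter_forall => j; have oc : (fun t => output (S t) i) @ U --> output q i by
    exact: output_cvg.
  by have /cvg_colP/(_ j)/cvgrPdist_lt := oc; apply.
have late : \forall t \near U, `|x| + tau <= t.
  by apply: ooU; apply: nbhs_pinfty_ge; exact: num_real.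
apply: filterS2 near_q late => t tq tl; split; first by have := normr_ge0 x; lra.
move=> s; rewrite ler_norml => /andP[st1 st2].
rewrite distrC; apply: Fd; split=> // j l; rewrite (ord1 l) /ball /=.
have -> : output q i j 0 - output (S s) i j 0 = (output q i j 0 - output (S t) i j 0) +
  (output (S t) i j 0 - output (S s) i j 0) by ring.
apply: le_lt_trans (ler_normD _ _) _.
have : `|output (S t) i j 0 - output (S s) i j 0| <= e1 * `|t - s|.
  apply: (primitive_lipschitz_after (oprim j) (normr_ge0 x)); rewrite ?ltry//; try lra.
  by move=> r xr _; apply/ltW/xslow; exact: le_lt_trans (ler_norm x) xr.
have : e1 * `|t - s| <= d / 2 / 2.
  have -> : d / 2 / 2 = e1 * tau by rewrite /e1; field; rewrite gt_eqF.
  by rewrite ler_pM2l// ler_norml; apply/andP; split; lra.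
have := tq j; lra.
Qed.

Let Mbound t a : 0 <= t -> - M <= coords (S t) a <= M.
Proof. by move=> t0; rewrite -ler_norml; exact: S_bounded. Qed.

(** [mu] is not yet known to converge, so Barbalat's argument is replaced by a drift: over a long
    window [mu] would move further than its bound allows. *)
Lemma limit_h i : h i (output q i) = 0.
Proof.
apply/eqP; apply: contrapT => /negP h0; set H := h i (output q i) in h0.
have e0 : 0 < `|H| / 2 by rewrite divr_gt0 ?normr_gt0.
have M0 : 0 <= M by apply: le_trans (S_bounded (inr i) (lexx 0)).
(* At speed at least [|H| / 2] the drift is at least [2 * M + 2], more than the diameter of
   [[- M, M]]. *)
pose tau := (4 * M + 4) / `|H|.
have tau0 : 0 < tau by rewrite divr_gt0 ?normr_gt0//; lra.
have ch : {for output q i, continuous (h i)}.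
  exact: (@h_cvg _ _ _ _ h_affine _ (nbhs (output q i)) id (output q i) i (nbhs_filter _)
    (@cvg_id _ _)).
have [t [tl th]] := filter_ex (slow_output ch tau0 e0).
have t0 : 0 <= t by lra.
have tt : t < t + tau by rewrite ltrDl.
have [r /andP[tr rt] /= ME] := primitive_mvt (prim (inr i)) t0 tt (ltry _).
have : `|h i (output (S r) i) - H| < `|H| / 2.
  by apply: th; rewrite ger0_norm; lra.
have t0' : 0 <= t + tau by lra.
have /= /andP[m1 m2] := Mbound (inr i) t0; have /= /andP[m3 m4] := Mbound (inr i) t0'.
rewrite addrAC subrr add0r in ME.
have Ht : `|H| * tau = 4 * M + 4 by rewrite /tau; field; rewrite normr_eq0.
rewrite ltr_norml => /andP[r1 r2]; have [Hs|Hs] := ltP 0 H.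
  rewrite (gtr0_norm Hs) in Ht r1 r2.
  have : 0 < (h i (output (S r) i) - H / 2) * tau by rewrite mulr_gt0//; lra.
  lra.
rewrite (ler0_norm Hs) in Ht r1 r2.
have : 0 < (H / 2 - h i (output (S r) i)) * tau by rewrite mulr_gt0//; lra.
lra.
Qed.

(* Outputs vary slowly near a limit point. If [g i (output q i)] were positive (negative),
   [lam] would grow linearly forward (backward) in time for an arbitrary duration. *)
Lemma limit_complementarity i : lam q i * g i (output q i) = 0.
Proof.
have [->|g0] := eqVneq (g i (output q i)) 0; first by rewrite mulr0.
suff -> : lam q i = 0 by rewrite mul0r.
set G := g i (output q i) in g0.
have e0 : 0 < `|G| / 2 by rewrite divr_gt0 ?normr_gt0.
have lq0 : 0 <= lam q i := lam_limit_ge0 UU ooU Sq i.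
apply/eqP; apply: contrapT => /negP lq; have {lq0}lq : 0 < lam q i by rewrite lt_def lq.
have M0 : 0 <= M by apply: le_trans (S_bounded (inr i) (lexx 0)).
(* [lam] would change at a rate of at least [|G| * lam q i / 2], thus by [M + 1] over [tau],
   although it stays between 0 and [M]. *)
pose tau := (2 * M + 2) / (`|G| * lam q i).
have tau0 : 0 < tau by rewrite divr_gt0 ?mulr_gt0 ?normr_gt0//; lra.
have cg : {for output q i, continuous (g i)} by exact: fun_continuous.
have lq2 : 0 < lam q i / 2 by rewrite divr_gt0.
have lt_near : \forall t \near U, lam q i / 2 < lam (S t) i.
  have /cvgrPdist_lt/(_ _ lq2) := @Sq (inl (inr i)); apply: filterS => t /=.
  by rewrite ltr_norml => /andP[? ?]; lra.
have [t [[tl tg] tlam]] := filter_ex (filterI (slow_output cg tau0 e0) lt_near).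
have t0 : 0 <= t by lra.
have Gt : `|G| * lam q i * tau = 2 * M + 2 by rewrite /tau; field; rewrite normr_eq0 g0
  gt_eqF.
have [Gpos|Gneg] := ltrP 0 G.
  have grow r : t <= r <= t + tau -> lam (S t) i <= lam (S r) i.
    move=> /andP[]; rewrite le_eqVlt => /predU1P[->//|tr rt].
    have [x /andP[tx xr] /= E1] := primitive_mvt (prim (inl (inr i))) t0 tr (ltry _).
    have : `|g i (output (S x) i) - G| < `|G| / 2 by apply: tg; rewrite ger0_norm; lra.
    rewrite (gtr0_norm Gpos) ltr_norml => /andP[x1 x2].
    have lx : 0 < lam (S x) i by apply: lam_pos; lra.
    by rewrite -subr_ge0 E1 !mulr_ge0//; lra.
  have tt : t < t + tau by rewrite ltrDl.
  have [x /andP[tx xr] /= E1] := primitive_mvt (prim (inl (inr i))) t0 tt (ltry _).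
  have : `|g i (output (S x) i) - G| < `|G| / 2 by apply: tg; rewrite ger0_norm; lra.
  rewrite (gtr0_norm Gpos) in Gt *; rewrite ltr_norml => /andP[x1 x2].
  have lx : lam (S t) i <= lam (S x) i by apply: grow; rewrite !ltW.
  have t0' : 0 <= t + tau by lra.
  have /= /andP[m1 m2] := Mbound (inl (inr i)) t0'.
  have := lam_pos i t0.
  rewrite addrAC subrr add0r in E1.
  have : G / 2 * lam q i <= 2 * lam (S x) i * g i (output (S x) i) by nra.
  rewrite -(ler_pM2r tau0); nra.
have {}Gneg : G < 0 by rewrite lt_def eq_sym g0.
have decay r : t - tau <= r <= t -> lam (S t) i <= lam (S r) i.
  move=> /andP[tr]; rewrite le_eqVlt => /predU1P[->//|rt].
  have r0 : 0 <= r by lra.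
  have [x /andP[tx xr] /= E1] := primitive_mvt (prim (inl (inr i))) r0 rt (ltry _).
  have : `|g i (output (S x) i) - G| < `|G| / 2.
    by apply: tg; rewrite ler_norml; apply/andP; split; lra.
  rewrite (ltr0_norm Gneg) ltr_norml => /andP[x1 x2].
  have lx : 0 < lam (S x) i by apply: lam_pos; lra.
  by rewrite -subr_le0 E1 mulr_le0_ge0//; [rewrite mulr_ge0_le0//; lra|lra].
have tt : t - tau < t by lra.
have r0 : 0 <= t - tau by lra.
have [x /andP[tx xr] /= E1] := primitive_mvt (prim (inl (inr i))) r0 tt (ltry _).
have : `|g i (output (S x) i) - G| < `|G| / 2.
  by apply: tg; rewrite ler_norml; apply/andP; split; lra.
rewrite (ltr0_norm Gneg) in Gt *; rewrite ltr_norml => /andP[x1 x2].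
have lx : lam (S t) i <= lam (S x) i by apply: decay; rewrite !ltW.
have /= /andP[m1 m2] := Mbound (inl (inr i)) r0.
have := lam_pos i t0.
rewrite subKr in E1.
have : - G / 2 * lam q i <= - (2 * lam (S x) i * g i (output (S x) i)) by nra.
rewrite -(ler_pM2r tau0); nra.
Qed.

Lemma limit_equilibrium : equil q.
Proof.
apply/equilibriumP; split=> [i|i k|i|i|i].
- exact: (limit_nu UU ooU Sq).
- exact: (limit_rho UU ooU Sq).
- exact: (limit_lap UU ooU Sq).
- exact: limit_complementarity.
- exact: limit_h.
Qed.

End one_limit_slow.

(** ** Convergence *)

Definition with_multipliers q : state := State (rho p) (xi q) (lam q) (mu q).

(* The dissipation relative to [p] vanishes at [q], so the gradients at [q] and [p] agree.
  *)
Lemma with_multipliers_equilibrium (U : set_system R) q :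
  UltraFilter U -> +oo `<=` U -> cvg_state U S q -> equil (with_multipliers q).
Proof.
move=> UU ooU Sq.
have [diss lg2] := limit_dissipation UU ooU Sq.
have [_ _ gf gg _] := dissipation_eq0 diss.
have qE : equil q by apply: (limit_equilibrium UU ooU Sq).
have /equilibriumP[nq _ lq _ _] := qE.
have /equilibriumP[_ bp lp _ hp] := p_equil.
apply/equilibriumP; split=> // i; last first.
  have /eqP := lg2 i; rewrite mulf_eq0 expf_eq0 /= => /orP[/eqP l0|/eqP g0].
    by rewrite l0 mul0r.
  by rewrite -[output (with_multipliers q) i]/(output p i) g0 mulr0.
rewrite -[RHS](nq i) !nuE /=.
have [a [aE _]] := affine_grad (h_affine i).
by rewrite -[output (with_multipliers q)]/(output p) -(gf i) (gg i) lp lq !aE.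
Qed.

(** The logarithmic term blows up as [lam (S t) i] approaches 0, while [lyap q] stays below its
    initial value; solving this bound for [ln (lam (S t) i)] gives the constant. *)
Lemma lam_bounded_below q i : equil q -> (forall i, g i (output q i) <= 0) ->
  (forall i, 0 <= lam q i) -> 0 < lam q i ->
  exists2 k : R, 0 < k & forall t, 0 <= t -> k <= lam (S t) i.
Proof.
move=> qE qg q0 lq; set a := lam q i in lq.
pose C := 4 * lyap q (S 0).
exists (expR (ln a - (C + a ^+ 2) / (2 * a ^+ 2))); first exact: expR_gt0.
move=> t t0; have lt := lam_pos i t0.
rewrite -[leRHS](lnK (x := lam (S t) i)) ?posrE// ler_expR.
have decr : lyap q (S t) <= lyap q (S 0).
  by apply: (lyap_nonincreasing S_solution); rewrite ?ltry.
have term : log_distance (lam (S t) i) a <= C.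
  have [|t1 t2 t3 t4] := @lyap_terms_ge0 q (S t) _ q0.
    by move=> j _; exact: lam_pos.
  have : log_distance (lam (S t) i) a / 4 <= lyap q (S t).
    rewrite /lyap [X in _ <= _ + X](bigD1 i)//= -/a.
    rewrite [X in _ <= X]addrCA lerDl !addr_ge0// ?sumr_ge0// => j _.
    by rewrite sumr_ge0.
  rewrite /C; lra.
have a2 : 0 < 2 * a ^+ 2 by rewrite mulr_gt0// exprn_gt0.
rewrite lerBlDr -lerBlDl ler_pdivlMr//.
move: term; rewrite /log_distance; have := sqr_ge0 (lam (S t) i); lra.
Qed.

Lemma limit_lam_positive (U : set_system R) q r i : UltraFilter U -> +oo `<=` U ->
  cvg_state U S r -> equil q -> (forall i, g i (output q i) <= 0) ->
  (forall i, 0 <= lam q i) -> 0 < lam q i -> 0 < lam r i.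
Proof.
move=> UU ooU Sr qE qg q0 lq; have [k k0 kS] := lam_bounded_below qE qg q0 lq.
apply: lt_le_trans k0 _.
have lr := @Sr (inl (inr i)).
have -> : lam r i = lim ((fun t => lam (S t) i) @ U) by apply/esym/cvg_lim.
apply: limr_ge; first exact: cvgP lr.
apply: ooU; near=> t; apply: kS; near: t; exact: nbhs_pinfty_ge.
Unshelve. all: by end_near. Qed.

(** The last premise ensures that [ln] is evaluated at a point of continuity; where [lam q i = 0]
    the logarithm disappears. *)
Lemma lyap_cvg (T : Type) (G : set_system T) (u : T -> state) q r : ProperFilter G ->
  cvg_state G u r -> (forall i, 0 <= lam q i) -> (forall i, 0 < lam q i -> 0 < lam r i) ->
  (fun t => lyap q (u t)) @ G --> lyap q r.
Proof.
move=> PG ur q0 qr; have /cvg_stateP[rs xs ls ms] := ur.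
apply: cvgD; first apply: cvgD; first apply: cvgD.
- apply: (@cvg_sum R R^o) => i _; apply: (@cvg_sum R R^o) => k _.
  apply: cvgM; first exact: cvg_cst.
  by apply: cvg_dot; apply: cvgB; try exact: rs; exact: cvg_cst.
- apply: (@cvg_sum R R^o) => i _; apply: cvgM; last exact: cvg_cst.
  by apply: cvg_dot; apply: cvgB; try exact: xs; exact: cvg_cst.
- apply: (@cvg_sum R R^o) => i _; apply: cvgM; last exact: cvg_cst.
  rewrite expr2; under eq_fun do rewrite expr2.
  by apply: cvgM; apply: cvgB; try exact: ms; exact: cvg_cst.
- apply: (@cvg_sum R R^o) => i _; apply: cvgM; last exact: cvg_cst.
  have l2 : (fun t => lam (u t) i ^+ 2) @ G --> lam r i ^+ 2.
    by rewrite expr2; under eq_fun do rewrite expr2; apply: cvgM; exact: ls.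
  have := q0 i; rewrite /log_distance le_eqVlt => /predU1P[<-|qi].
    rewrite expr0n /= mulr0 mul0r !subr0.
    by under eq_fun do rewrite mul0r !subr0.
  apply: cvgB; first by apply: cvgB; [exact: l2|exact: cvg_cst].
  apply: cvgM; first exact: cvg_cst.
  apply: cvgB; last exact: cvg_cst.
  exact: (cvg_comp _ _ (ls i) (continuous_ln (qr i qi))).
Qed.

(* Both [with_multipliers q1] and [with_multipliers q2] are saddle points, so the two
   associated Lyapunov functions take the same value at [q1] and [q2]; summing the two
   equalities cancels the [rho] parts and leaves two nonnegative terms. *)
Lemma limit_lam_unique (U1 U2 : set_system R) q1 q2 i :
  UltraFilter U1 -> +oo `<=` U1 -> cvg_state U1 S q1 ->
  UltraFilter U2 -> +oo `<=` U2 -> cvg_state U2 S q2 -> lam q1 i = lam q2 i.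
Proof.
have main (V1 V2 : set_system R) r1 r2 :
    UltraFilter V1 -> +oo `<=` V1 -> cvg_state V1 S r1 ->
    UltraFilter V2 -> +oo `<=` V2 -> cvg_state V2 S r2 ->
    lyap (with_multipliers r1) r1 = lyap (with_multipliers r1) r2 /\
    forall i, 0 < lam r1 i -> 0 < lam r2 i.
  move=> VV1 ooV1 Sr1 VV2 ooV2 Sr2.
  have rE := with_multipliers_equilibrium VV1 ooV1 Sr1.
  have l0 j : 0 <= lam r1 j := lam_limit_ge0 VV1 ooV1 Sr1 j.
  have pos j : 0 < lam r1 j -> 0 < lam r2 j.
    exact: (limit_lam_positive VV2 ooV2 Sr2 rE).
  split=> //; have [l Ll] := lyap_limit rE p_feasible l0.
  have L1 := lyap_cvg (@ultra_proper _ _ VV1) Sr1 (q := with_multipliers r1) l0 (fun _ =>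
    id).
  have L2 := lyap_cvg (@ultra_proper _ _ VV2) Sr2 (q := with_multipliers r1) l0 pos.
  have Ll1 : (fun t => lyap (with_multipliers r1) (S t)) @ V1 --> l by move=> B /Ll /ooV1.
  have Ll2 : (fun t => lyap (with_multipliers r1) (S t)) @ V2 --> l by move=> B /Ll /ooV2.
  rewrite -(cvg_lim _ L1)// -(cvg_lim _ L2)// (cvg_lim _ Ll1)// (cvg_lim _ Ll2)//.
move=> UU1 ooU1 S1 UU2 ooU2 S2.
have [e12 p12] := main _ _ _ _ UU1 ooU1 S1 UU2 ooU2 S2.
have [e21 p21] := main _ _ _ _ UU2 ooU2 S2 UU1 ooU1 S1.
have l1 j : 0 <= lam q1 j := lam_limit_ge0 UU1 ooU1 S1 j.
have l2 j : 0 <= lam q2 j := lam_limit_ge0 UU2 ooU2 S2 j.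
have [_ x12 m12 d12] := @lyap_terms_ge0 (with_multipliers q1) q2 p12 l1.
have [_ x21 m21 d21] := @lyap_terms_ge0 (with_multipliers q2) q1 p21 l2.
pose X (r : state) := \sum_i \sum_k (c i k)^-1 / 2 * dot (rho r i k - rho p i k) (rho r i k
  - rho p i k).
pose Y (r s : state) := \sum_i dot (xi r i - xi s i) (xi r i - xi s i) / 2.
pose Z (r s : state) := \sum_i (mu r i - mu s i) ^+ 2 / 2.
pose V (r s : state) := \sum_i log_distance (lam r i) (lam s i) / 4.
have {}e12 : X q1 + Y q1 q1 + Z q1 q1 + V q1 q1 = X q2 + Y q2 q1 + Z q2 q1 + V q2 q1 := e12.
have {}e21 : X q2 + Y q2 q2 + Z q2 q2 + V q2 q2 = X q1 + Y q1 q2 + Z q1 q2 + V q1 q2 := e21.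
have Yxx r : Y r r = 0 by rewrite /Y big1// => j _; rewrite subrr dot0l mul0r.
have Zxx r : Z r r = 0 by rewrite /Z big1// => j _; rewrite subrr expr0n mul0r.
have Vxx r : V r r = 0 by rewrite /V big1// => j _; rewrite log_distancexx mul0r.
have s12 : V q2 q1 <= 0.
  have : 0 <= Y q2 q1 by exact: sumr_ge0.
  have : 0 <= Z q2 q1 by exact: sumr_ge0.
  have : 0 <= Y q1 q2 by exact: sumr_ge0.
  have : 0 <= Z q1 q2 by exact: sumr_ge0.
  have : 0 <= V q1 q2 by exact: sumr_ge0.
  move: e12 e21; rewrite !Yxx !Zxx !Vxx; lra.
have : log_distance (lam q2 i) (lam q1 i) / 4 <= 0.
  by apply: le_trans s12; rewrite /V [leRHS](bigD1 i)//= lerDl sumr_ge0.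
have := log_distance_ge (p12 i) (l1 i).
set d := lam q2 i - lam q1 i => h1 h2.
have : d ^+ 2 = 0 by apply/le_anti; rewrite sqr_ge0 andbT; lra.
by move/eqP; rewrite sqrf_eq0 subr_eq0 => /eqP.
Qed.

(** * Capture of the trajectory by a limit point *)

Section capture.
Variable U : set_system R.
Hypothesis UU : UltraFilter U.
Hypothesis ooU : +oo `<=` U.
Let UP : ProperFilter U := ultra_proper.
Variable q : state.
Hypothesis Sq : cvg_state U S q.

Let qE : equil q.
Proof.
exact: (limit_equilibrium UU ooU Sq).
Qed.

Let q0 i : 0 <= lam q i.
Proof. exact: (lam_limit_ge0 UU ooU Sq i). Qed.

Lemma lam_cvg i : (fun t => lam (S t) i) @ +oo --> lam q i.
Proof.
apply: cvg_ultra => V VV ooV; have [r Sr] := limit_point_exists VV ooV.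
by rewrite (limit_lam_unique i UU ooU Sq VV ooV Sr); exact: (@Sr (inl (inr i))).
Qed.

Let bad i := 0 < g i (output q i).

Let bad_lam i : bad i -> lam q i = 0.
Proof.
move=> bi; have /equilibriumP[_ _ _ lg _] := qE.
by have /eqP := lg i; rewrite mulf_eq0 (gt_eqF bi) orbF => /eqP.
Qed.

(* Near [q] every multiplier of a constraint violated at [q] grows, so that its square
   pays for the only positive terms in the derivative of [lyap q]. *)
Lemma lyap_limit_point_cvg0 (e : R) : 0 < e -> \forall t \near +oo, lyap q (S t) < e.
Proof.
move=> e0; have [B B0 coer] := lyap_coercive.
have PF := coord_nbhs_filter (coords q).
have cq : cvg_state (coord_nbhs (coords q)) (fun r => of_coords r) q.
  move=> a; apply/cvgrPdist_lt => d d0; exists d => // r /= /(_ a).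
  by rewrite of_coordsK distrC.
have : \forall r \near coord_nbhs (coords q), forall i, bad i ->
    g i (output q i) / 2 < g i (output (of_coords r) i).
  apply: filter_forall => i; have [bi|nb] := boolP (bad i); last first.
    by apply: filterE => r.
  have b2 : 0 < g i (output q i) / 2 by rewrite divr_gt0.
  have gc : (fun r => g i (output (of_coords r) i)) @ coord_nbhs (coords q) --> g i (output
    q i).
    exact: (continuous_output_cvg _ cq (fun_continuous (g_diff i))).
  have /cvgrPdist_lt/(_ _ b2) := gc; apply: filterS => r + _.
  by rewrite ltr_norml => /andP[? ?]; lra.
move=> [d /= d0 dg].
(* By coercivity, [lyap q (S t) < d ^+ 2 / B] puts every coordinate of [S t] within [d] of [q]. *)
pose eta := Num.min e (d ^+ 2 / B).
have eta0 : 0 < eta by rewrite lt_min e0 divr_gt0// exprn_gt0.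
have near_q t i : 0 <= t -> lyap q (S t) < eta -> bad i ->
    g i (output q i) / 2 < g i (output (S t) i).
  move=> t0 lt bi; rewrite -[S t]coordsK; apply: dg => // a.
  have := coer q (S t) (fun i _ => lam_pos i t0) q0 a.
  move: lt; rewrite lt_min => /andP[_]; rewrite ltr_pdivlMr// mulrC => lt le.
  rewrite -(ltr_pXn2r (n := 2)) ?nnegrE ?normr_ge0 ?ltW//.
  by rewrite real_normK ?num_real//; exact: le_lt_trans lt.
(* With weight [1 / 2], the derivative of [P] is the sum of [2 * lam ^+ 2 * g] over the constraints
   violated at [q], and near [q] the factor [2 * g] exceeds [g i (output q i)]. *)
pose w i : R := (bad i)%:R / 2.
pose P t := \sum_i w i * (lam (S t) i - 0) ^+ 2.
have w0 i : 0 <= w i by rewrite divr_ge0.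
have P0 t : 0 <= P t by apply: sumr_ge0 => i _; rewrite mulr_ge0 ?sqr_ge0.
have Pcvg : P @ +oo --> (0 : R).
  have : P @ +oo --> \sum_i w i * ((lam q i - 0) * (lam q i - 0)).
    apply: (@cvg_sum R R^o) => i _; under eq_fun do rewrite expr2.
    apply: cvgM; first exact: cvg_cst.
    by apply: cvgM; apply: cvgB; try exact: lam_cvg; exact: cvg_cst.
  rewrite big1// => i _; rewrite /w; have [/bad_lam ->|_] := boolP (bad i).
    by rewrite subrr mul0r mulr0.
  by rewrite mul0r mul0r.
have eta2 : 0 < eta / 2 by rewrite divr_gt0.
have /cvgrPdist_lt/(_ _ eta2)[x [_ xP]] := Pcvg.
have lq : (fun t => lyap q (S t)) @ U --> lyap q q by exact: lyap_cvg.
have lqq : lyap q q = 0.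
  rewrite /lyap !big1 ?addr0// => i _; last first.
  - by rewrite big1// => k _; rewrite subrr dot0l mulr0.
  - by rewrite subrr dot0l mul0r.
  - by rewrite subrr expr0n mul0r.
  - by rewrite log_distancexx mul0r.
have late : \forall t \near U, `|x| + 1 <= t.
  by apply: ooU; apply: nbhs_pinfty_ge; exact: num_real.
rewrite lqq in lq; have /cvgrPdist_lt/(_ _ eta2) lsmall := lq.
have [t0 [t0x lt0]] := filter_ex (filterI late lsmall).
have t0_gt0 : 0 < t0 by have := normr_ge0 x; lra.
have xt0 : x < t0 by have := ler_norm x; lra.
rewrite sub0r normrN in lt0; have {}lt0 : lyap q (S t0) < eta / 2.
  by apply: le_lt_trans (ler_norm _) lt0.
have LP := lyap_primitive S_solution lam_init q.
have WP := scalar_primitiveD LP (scalar_primitiveZ (-1) (scalar_primitive_sum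
  (fun i => scalar_primitiveZ (w i) (scalar_primitive_sqr 0 (prim (inl (inr i))))))).
have cont t : 0 < t -> {for t, continuous (fun t => lyap q (S t))}.
  by move=> tp; apply: (scalar_primitive_cvg LP); rewrite ?ltry.
have stay : forall t, t0 <= t -> lyap q (S t) < eta.
  apply: first_exit.
  - by move=> t t0t; apply: cont; lra.
  - by apply: cvg_at_right_filter; exact: cont.
  - lra.
  (* While [lyap q] stays below [eta], the difference of [lyap q] and [P] does not increase;
     [lyap q (S t0)] and [P t] are both below [eta / 2]. *)
  move=> t t0t below.
  have := primitive_nonincreasing WP (ltW t0_gt0) (ltW t0t) (ltry _).
  rewrite /= !mulN1r -/(P t) -/(P t0).
  have Pt : P t < eta / 2.
    have := xP t (lt_trans xt0 t0t); rewrite sub0r normrN => /(le_lt_trans (ler_norm _)).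
    by [].
  move=> H; suff /H : forall r, t0 < r < t -> lyap_rate q (S r) +
    - 1 * \sum_j w j * (2 * ((lam (S r) j - 0) * (2 * lam (S r) j * g j (output (S r) j))))
      <= 0.
    by have := P0 t0; lra.
  move=> r rt; have /andP[r1 r2] := rt; have r0 : 0 <= r by lra.
  rewrite (lyap_rateE _ qE).
  have := dissipation_ge0 q (S r).
  suff : \sum_i lam (S r) i ^+ 2 * g i (output q i) <=
     \sum_j w j * (2 * ((lam (S r) j - 0) * (2 * lam (S r) j * g j (output (S r) j)))) by
       lra.
  apply: ler_sum => i _; rewrite /w; have [bi|nb] := boolP (bad i); last first.
    rewrite !mul0r mulr_ge0_le0 ?sqr_ge0//.
    by rewrite leNgt.
  have := near_q r i r0 (below r rt) bi => gr.
  have -> : 1%:R / 2 * (2 * ((lam (S r) i - 0) * (2 * lam (S r) i * g i (output (S r) i))))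
    =
    lam (S r) i ^+ 2 * (2 * g i (output (S r) i)) by field.
  by rewrite ler_wpM2l ?sqr_ge0//; lra.
near=> t; apply: lt_le_trans (stay t _) _; last by rewrite ge_min lexx.
near: t; apply: nbhs_pinfty_ge; exact: num_real.
Unshelve. all: by end_near. Qed.

Lemma solution_converges : cvg_state +oo S q.
Proof.
move=> a; have [B B0 coer] := lyap_coercive.
apply/cvgrPdist_lt => e e0.
have eB : 0 < e ^+ 2 / B by rewrite divr_gt0// exprn_gt0.
near=> t; have t0 : 0 <= t by near: t; exact: nbhs_pinfty_ge.
have : lyap q (S t) < e ^+ 2 / B by near: t; exact: lyap_limit_point_cvg0.
rewrite ltr_pdivlMr// mulrC => lt.
have le := coer q (S t) (fun i _ => lam_pos i t0) q0 a.
rewrite distrC -(ltr_pXn2r (n := 2)) ?nnegrE ?normr_ge0 ?ltW//.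
by rewrite real_normK ?num_real//; exact: le_lt_trans lt.
Unshelve. all: by end_near. Qed.

Lemma limit_feasible i : g i (output q i) <= 0.
Proof.
rewrite leNgt; apply/negP => bi; have l0 := bad_lam bi.
have gc : (fun t => g i (output (S t) i)) @ +oo --> g i (output q i).
  exact: (continuous_output_cvg _ solution_converges (fun_continuous (g_diff i))).
have /cvgrPdist_lt/(_ _ bi)[x [_ xg]] := gc.
pose t0 := `|x| + 1.
have t0p : 0 < t0 by have := normr_ge0 x; rewrite /t0; lra.
have lt0 := lam_pos i (ltW t0p).
have grow t : t0 <= t -> lam (S t0) i <= lam (S t) i.
  rewrite le_eqVlt => /predU1P[->//|tt].
  have [r /andP[tr rt] /= E1] := primitive_mvt (prim (inl (inr i))) (ltW t0p) tt (ltry _).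
  have xr : x < r by have := ler_norm x; move: tr; rewrite /t0; lra.
  have := xg r xr; rewrite ltr_norml => /andP[g1 g2].
  have lr : 0 < lam (S r) i by apply: lam_pos; lra.
  by rewrite -subr_ge0 E1 !mulr_ge0//; lra.
suff : lam (S t0) i <= lam q i by rewrite l0 leNgt lt0.
have lc := @lam_cvg i; rewrite -(cvg_lim _ lc)//; apply: limr_ge; first exact: cvgP lc.
near=> t; apply: grow; near: t; apply: nbhs_pinfty_ge; exact: num_real.
Unshelve. all: by end_near. Qed.

End capture.

Lemma solution_cvg_feasible_equilibrium : exists q, [/\ cvg_state +oo S q, equil q,
  forall i, 0 <= lam q i & forall i, g i (output q i) <= 0].
Proof.
have [U [UU ooU]] := ultraFilterLemma (@proper_pinfty_nbhs R).
have [q Sq] := limit_point_exists UU ooU.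
exists q; split.
- exact: (solution_converges UU ooU Sq).
- exact: (limit_equilibrium UU ooU Sq).
- exact: (lam_limit_ge0 UU ooU Sq).
- exact: (limit_feasible UU ooU Sq).
Qed.

End convergence.

(** * Optimality *)

Section stacking.
Variables (R : realType) (N n : nat) (A : 'M[R]_N).

Lemma stackK (x : 'I_N -> 'cV[R]_n) : block (stack x) = x.
Proof. by apply/funext => i; apply/colP => j; rewrite !mxE mxtens_indexK. Qed.

Lemma big_laplacianE (y : 'cV[R]_(N * n)) i k :
  (big_laplacian n A *m y) (mxtens_index (i, k)) 0 = - lap A (block y) i k 0.
Proof.
rewrite mxE (reindex (@mxtens_index N n)) /=; last first.
  by exists (@mxtens_unindex N n) => p _; rewrite (mxtens_indexK, mxtens_unindexK).
transitivity (\sum_j laplacian A i j * block y j k 0).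
  transitivity (\sum_j \sum_l big_laplacian n A (mxtens_index (i, k)) (mxtens_index (j, l))
    *
      y (mxtens_index (j, l)) 0).
    by rewrite pair_bigA; apply: eq_bigr => -[].
  apply: eq_bigr => j _; rewrite (bigD1 k)//= big1 ?addr0 => [|l lk].
    by rewrite tensmxE !mxE eqxx mulr1.
  by rewrite tensmxE [1%:M _ _]mxE eq_sym (negbTE lk) mulr0 mul0r.
have lapE : lap A (block y) i k 0 = \sum_j A i j * block y j k 0 - \sum_j A i j * block y i
  k 0.
  by rewrite /lap summxE -sumrB; apply: eq_bigr => j _; rewrite !mxE mulrBr.
have lE j : laplacian A i j = (\sum_l A i l) *+ (i == j) - A i j.
  rewrite !mxE; congr (_ *+ _ - _); apply: eq_bigr => l _.
  by rewrite mxE mulr1.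
rewrite lapE opprB; under eq_bigr do rewrite lE mulrBl.
rewrite sumrB; congr (_ - _); rewrite (bigD1 i)//= eqxx mulr1n [X in _ + X]big1 ?addr0.
  by rewrite mulr_suml.
by move=> j ji; rewrite eq_sym (negbTE ji) mulr0n mul0r.
Qed.

Lemma big_laplacian_eq0 (y : 'cV[R]_(N * n)) :
  big_laplacian n A *m y = 0 <-> forall i, lap A (block y) i = 0.
Proof.
split=> [y0 i|y0].
  by apply/colP => k; apply: oppr_inj; rewrite -big_laplacianE y0 !mxE oppr0.
apply/colP => r; case: (mxtens_indexP r) => i k.
by rewrite big_laplacianE y0 !mxE oppr0.
Qed.

End stacking.

(** Convexity bounds each [f i] from below by its linearisation at the equilibrium, where
    stationarity replaces the gradient. The [xi] terms cancel in the sum, the Laplacian being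
    symmetric and both points lying in its kernel, on which the quadratic term vanishes too. *)
Lemma equilibrium_optimal (R : realType) (N n m : nat) (f g h : 'I_N -> 'cV[R]_n -> R)
    (E : rel 'I_N) (A : 'M[R]_N) (b c : 'I_N -> 'I_m -> R) (q : state R N n m) :
  (forall i, convex_function setT (f i)) -> (forall i, convex_function setT (g i)) ->
  (forall i z, differentiable (f i) z) -> (forall i z, differentiable (g i) z) ->
  (forall i, affine_function (h i)) -> adjacency_matrix E A ->
  (forall i, exists k, b i k = 0) -> (forall i k, 0 < c i k) ->
  equilibrium f g h E A b c q -> (forall i, g i (output q i) <= 0) ->
  stacked_optimal f g h A (stack (output q)).
Proof.
move=> fc gc df dg ha AA b0 c0 /(equilibriumP _ _ _ AA b0 c0)[nq _ lq lg hq] gq.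
have quad0 (y : 'cV[R]_(N * n)) : big_laplacian n A *m y = 0 ->
    (y^T *m big_laplacian n A *m y) 0 0 = 0.
  by move=> y0; rewrite -mulmxA y0 mulmx0 mxE.
have Lq : big_laplacian n A *m stack (output q) = 0.
  by apply/big_laplacian_eq0; rewrite stackK.
split; first by split=> // i; rewrite stackK.
move=> y [yf Ly]; rewrite !quad0// !addr0 stackK.
have {Ly}/big_laplacian_eq0 Ly := Ly.
set x := output q; set z := block y in yf Ly *.
have xi0 : \sum_i dot (lap A (xi q) i) (z i - x i) = 0.
  rewrite (lap_sym AA) big1// => i _.
  by rewrite lapB Ly lq subr0 dotC dot0l.
have key i : f i (x i) - dot (lap A (xi q) i) (z i - x i) <= f i (z i).
  have b1 := bregman_ge0 (z i) (fc i) (df i (x i)).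
  have b2 := bregman_ge0 (z i) (gc i) (dg i (x i)).
  have [a [aE hB]] := affine_grad (ha i).
  have hz : dot a (z i - x i) = 0 by rewrite -hB hq; case: (yf i) => _ ->; rewrite subr0.
  have := nq i; rewrite (nuE _ _ _ AA) -/x lq addr0 aE => n0.
  have : dot (lap A (xi q) i) (z i - x i) = - dot (grad (f i) (x i)) (z i - x i) - lam q i
    ^+ 2 * dot (grad (g i) (x i)) (z i - x i).
    have -> : lap A (xi q) i = - grad (f i) (x i) - lam q i ^+ 2 *: grad (g i) (x i) - mu q
      i *: a.
      by apply/esym/eqP; rewrite -subr_eq0 n0.
    by rewrite !dotBl dotNl !dotZl hz mulr0 subr0.
  have g0 : lam q i ^+ 2 * g i (x i) = 0 by rewrite expr2 -mulrA lg mulr0.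
  have gz : lam q i ^+ 2 * g i (z i) <= 0 by rewrite mulr_ge0_le0 ?sqr_ge0//; case: (yf i).
  have := mulr_ge0 (sqr_ge0 (lam q i)) b2.
  move: b1; rewrite /bregman !mulrBr; lra.
have : \sum_i (f i (x i) - dot (lap A (xi q) i) (z i - x i)) <= \sum_i f i (z i) by exact:
  ler_sum.
by rewrite sumrB xi0 subr0.
Qed.

Theorem theorem1 (R : realType) (N n m : nat)
    (f g h : 'I_N -> 'cV[R]_n -> R)
    (E : rel 'I_N) (A : 'M[R]_N)
    (b c : 'I_N -> 'I_m -> R)
    (f_convex : forall i, convex_function setT (f i))
    (g_convex : forall i, convex_function setT (g i))
    (f_diff : forall i, twice_differentiable (f i))
    (g_diff : forall i, twice_differentiable (g i))
    (h_affine : forall i, affine_function (h i))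
    (slater_cond : slater g h)
    (optimum_exists : exists z, common_optimal f g h z)
    (E_undirected : symmetric E)
    (E_connected : connected_graph E)
    (A_adjacency : adjacency_matrix E A)
    (m_ge2 : (2 <= m)%N)
    (b_first : forall i (k : 'I_m), val k = 0%N -> b i k = 0)
    (b_increasing : forall i (k l : 'I_m), (k < l)%N -> b i k < b i l)
    (c_positive : forall i k, 0 < c i k)
    (T : \bar R) (S : R -> state R N n m)
    (S_trajectory : trajectory f g h E A b c T S)
    (lam_init : forall i, 0 < lam (S 0) i) :
  T = +oo%E /\
  exists s : state R N n m,
    [/\ converges_to S s,
        equilibrium f g h E A b c s
      & stacked_optimal f g h A (stack (output s))].
Proof.
have m_gt0 : (0 < m)%N by apply: leq_trans m_ge2.
pose k0 := Ordinal m_gt0; pose k1 := Ordinal m_ge2.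
have b_zero i : b i k0 = 0 by exact: b_first.
have b_ge0 i k : 0 <= b i k.
  have [k_eq0|k_gt0] := posnP (val k); first by rewrite b_first.
  by rewrite -(b_zero i) ltW// b_increasing.
have b_null i : exists k, b i k = 0 by exists k0.
have b_pos i : exists k, b i k != 0.
  by exists k1; rewrite gt_eqF// -(b_zero i) b_increasing.
have df i z : differentiable (f i) z by case: (f_diff i).
have dg i z : differentiable (g i) z by case: (g_diff i).
have [z z_opt] := optimum_exists.
have [xi0 [lam0 [mu0 [lam0_ge0 lam0g kkt0]]]] :=
  kkt df dg g_convex h_affine slater_cond A_adjacency E_connected z_opt.
(* At an equilibrium only components with [b i k = 0] can be nonzero, so the first one carries all
   of [z]. *)
pose p : state R N n m := State (fun i k => if k == k0 then z else 0) xi0 lam0 mu0.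
have pE : output p = fun=> z.
  apply/funext => i; rewrite /output (bigD1 k0)//= big1 ?addr0// => k kk0.
  by rewrite (negbTE kk0).
have [z_feas _] := z_opt.
have lap_z i : lap A (output p) i = 0 by apply: lap_cst => j l; rewrite pE.
have p_equil : equilibrium f g h E A b c p.
  apply/(equilibriumP _ _ _ A_adjacency b_null c_positive); split=> [i|i k|//|i|i].
  - by rewrite (nuE _ _ _ A_adjacency) lap_z addr0 pE /= kkt0.
  - by rewrite /=; case: eqP => [->|_]; rewrite ?b_zero ?scale0r ?scaler0.
  - by rewrite pE.
  - by rewrite pE; case: (z_feas i).
have p_feasible i : g i (output p i) <= 0 by rewrite pE; case: (z_feas i).
have [M S_bounded] := solution_bounded f_convex g_convex f_diff g_diff h_affine A_adjacency
  b_ge0 b_null c_positive S_trajectory.1 lam_init p_equil p_feasible lam0_ge0.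
have TE := bounded_trajectory_global f_diff g_diff h_affine S_trajectory S_bounded.
split=> //; subst T.
have [|q [Sq qE q_lam q_feas]] := solution_cvg_feasible_equilibrium f_convex g_convex f_diff
  g_diff h_affine A_adjacency E_connected b_ge0 b_null b_pos c_positive S_trajectory.1
    lam_init
  (M := M) _ p_equil p_feasible lam0_ge0.
  by move=> t a t0; apply: S_bounded; split=> //; rewrite ltry.
exists q; split=> //; first by apply/cvg_stateP.
exact: (equilibrium_optimal f_convex g_convex df dg h_affine A_adjacency b_null c_positive).
Qed.
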